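(* Let $H$ be an infinite dimensional complex Hilbert space and let $T \in \overline{\mathcal{AN}(H)}$ be a $\ast$-paranormal operator. If $T$ is invertible, then $T$ is normal.
   Context: An operator $T \in \mathcal{B}(H)$ (bounded linear operators on $H$) is absolutely norm attaining, written $T \in \mathcal{AN}(H)$, if for every nonzero closed subspace $L$ of $H$ there is a unit vector $x \in L$ with $\|Tx\| = \|T|_L\|$. $\overline{\mathcal{AN}(H)}$ is the closure of $\mathcal{AN}(H)$ in the operator norm. $T$ is $\ast$-paranormal if $\|T^*x\|^2 \leq \|T^2x\|\,\|x\|$ for all $x \in H$. Invertible means invertible in $\mathcal{B}(H)$. *)

(* Defs.v *)
From HB Require Import structures.
From mathcomp Require Import all_boot all_order all_algebra.
From mathcomp Require Import sesquilinear.
From mathcomp Require Import complex.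
From mathcomp Require Import all_classical all_reals all_analysis.

Set Implicit Arguments.
Unset Strict Implicit.
Unset Printing Implicit Defensive.

Import Order.TTheory GRing.Theory Num.Theory.
Import numFieldNormedType.Exports.

Local Open Scope classical_set_scope.
Local Open Scope ring_scope.
Local Open Scope complex_scope.

(* Scalars are R[i] with R : realType. As everywhere in MathComp-Analysis, the
   norm of a normed module over R[i] takes its values in R[i] (nonnegative
   reals). The inner product is linear in its first argument and
   conjugate-linear in the second. *)
HB.mixin Record CompleteNormedModule_isHilbert (R : realType) H
    & CompleteNormedModule R[i] H := {
  inner : {dot H for @Num.conj R[i]} ;
  innerxx : forall x : H, inner x x = `|x| ^+ 2
}.

#[short(type="hilbertType")]
HB.structure Definition Hilbert (R : realType) :=
  {H of CompleteNormedModule R[i] H & CompleteNormedModule_isHilbert R H}.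

Definition infinite_dimensional (R : realType) (H : hilbertType R) : Prop :=
  ~ exists (n : nat) (e : 'I_n -> H),
      forall x : H, exists a : 'I_n -> R[i], x = \sum_(i < n) a i *: e i.

(* Norm of the restriction f|_L, i.e. the supremum of `|f x| over the unit ball
   of L. [sup] lives in R; [Re] loses nothing since `|f x| is real. *)
Definition opnorm_on (R : realType) (H : normedModType R[i]) (L : set H)
    (f : H -> H) : R[i] :=
  (sup [set complex.Re `|f x| | x in L `&` [set x | `|x| <= 1]])%:C.

Section BoundedOperators.
Context (R : realType) (H : normedModType R[i]).
Implicit Types (f g : H -> H) (x : H).

Definition bounded_linear : {pred H -> H} :=
  [pred f | `[< linear f /\ exists M : R, forall x, `|f x| <= M%:C * `|x| >]].

Let ReK (z : R[i]) : 0 <= z -> (complex.Re z)%:C = z.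
Proof. by move=> z0; rewrite (RRe_real (ger0_real z0)). Qed.

Let RleC (a b : R) : (a%:C <= b%:C) = (a <= b).
Proof. exact: lecR. Qed.

Let Rge0C (a : R) : (0 <= a%:C) = (0 <= a).
Proof. exact: ler0c. Qed.

Let RaddC (a b : R) : (a + b)%:C = a%:C + b%:C.
Proof. exact: rmorphD. Qed.

Let RmulC (a b : R) : (a * b)%:C = a%:C * b%:C.
Proof. exact: rmorphM. Qed.

Record bounded_op : Type := BoundedOp {
  bop_fun :> H -> H ;
  _ : bop_fun \in bounded_linear
}.

HB.instance Definition _ := [isSub for bop_fun].
HB.instance Definition _ := [Choice of bounded_op by <:].

Lemma bounded_linear_submod_closed : submod_closed bounded_linear.
Proof.
split.
  apply/asboolP; split.
    by move=> a x y; rewrite -[0]/(cst 0) /= scaler0 addr0.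
  by exists 0 => x; rewrite mul0r -[0]/(cst 0) /= normr0.
move=> a f g /asboolP[lf [M fM]] /asboolP[lg [N gN]]; apply/asboolP; split.
  move=> b x y; rewrite !fctE lf lg !scalerDr !scalerA (mulrC a b).
  by rewrite addrACA.
exists (complex.Re `|a| * M + N) => x; rewrite !fctE.
rewrite (le_trans (ler_normD _ _))// RaddC mulrDl lerD// normrZ.
by rewrite RmulC ReK// -mulrA ler_wpM2l.
Qed.

HB.instance Definition _ :=
  GRing.isSubmodClosed.Build _ _ bounded_linear bounded_linear_submod_closed.
HB.instance Definition _ := [SubChoice_isSubLmodule of bounded_op by <:].

Lemma bounded_op_linear (T : bounded_op) : linear T.
Proof. by case: T => f fP; have /asboolP[] := fP. Qed.

HB.instance Definition _ (T : bounded_op) :=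
  GRing.isLinear.Build R[i] H H _ T (bounded_op_linear T).

Lemma bounded_opP (T : bounded_op) :
  exists M : R, forall x, `|T x| <= M%:C * `|x|.
Proof. by case: T => f fP; have /asboolP[] := fP. Qed.

Let ball1 : set H := setT `&` [set x | `|x| <= 1].

Let normC x : `|x| = (complex.Re `|x|)%:C.
Proof. by rewrite ReK. Qed.

Let Re_norm_ge0 x : 0 <= complex.Re `|x|.
Proof. by rewrite -Rge0C ReK. Qed.

Let has_sup_op (T : bounded_op) :
  has_sup [set complex.Re `|T x| | x in ball1].
Proof.
split; first by exists (complex.Re `|T 0|), 0; split => //=; rewrite normr0.
have [M TM] := bounded_opP T.
exists `|M| => _ [x [_ /= x1] <-].
rewrite -RleC -normC (le_trans (TM x))//.
have M0 : M%:C <= `|M|%:C by rewrite RleC ler_norm.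
rewrite (le_trans (ler_wpM2r _ M0))//.
by rewrite ler_piMr// Rge0C.
Qed.

Lemma opnorm_ge0 (T : bounded_op) : 0 <= opnorm_on setT T.
Proof.
rewrite Rge0C; apply: (le_trans (Re_norm_ge0 (T 0))).
by apply: sup_ubound; [case: (has_sup_op T)|exists 0 => //; split => //=; rewrite normr0].
Qed.

Lemma le_opnorm (T : bounded_op) x : `|T x| <= opnorm_on setT T * `|x|.
Proof.
have [->|x0] := eqVneq x 0; first by rewrite linear0 !normr0 mulr0.
have nx0 : 0 < `|x| by rewrite normr_gt0.
rewrite -ler_pdivrMr//.
have -> : `|T x| / `|x| = `|T (`|x|^-1 *: x)|.
  by rewrite linearZ normrZ normfV normr_id mulrC.
rewrite normC RleC.
apply: sup_ubound; first by case: (has_sup_op T).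
exists (`|x|^-1 *: x) => //; split => //=.
by rewrite normrZ normfV normr_id mulVf// gt_eqF.
Qed.

Lemma opnorm_le (T : bounded_op) (M : R) : 0 <= M ->
  (forall x, `|T x| <= M%:C * `|x|) -> opnorm_on setT T <= M%:C.
Proof.
move=> M0 TM; rewrite RleC; apply: ge_sup; first by case: (has_sup_op T).
move=> _ [x [_ /= x1] <-]; rewrite -RleC -normC (le_trans (TM x))//.
by rewrite ler_piMr// Rge0C.
Qed.

Let opnormD (S T : bounded_op) :
  opnorm_on setT (S + T : bounded_op) <= opnorm_on setT S + opnorm_on setT T.
Proof.
rewrite /opnorm_on -RaddC; apply: opnorm_le.
  by rewrite addr_ge0// -Rge0C; exact: opnorm_ge0.
move=> x; rewrite RaddC mulrDl.
by rewrite (le_trans (ler_normD _ _))// lerD// le_opnorm.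
Qed.

Let opnormZ_le (a : R[i]) (T : bounded_op) :
  opnorm_on setT (a *: T : bounded_op) <= `|a| * opnorm_on setT T.
Proof.
have ge0 : 0 <= `|a| * opnorm_on setT T by rewrite mulr_ge0// opnorm_ge0.
rewrite -(ReK ge0); apply: opnorm_le => [|x]; first by rewrite -Rge0C ReK.
by rewrite ReK// normrZ -mulrA ler_wpM2l// le_opnorm.
Qed.

Let opnormZ (a : R[i]) (T : bounded_op) :
  opnorm_on setT (a *: T : bounded_op) = `|a| * opnorm_on setT T.
Proof.
apply/eqP; rewrite eq_le opnormZ_le andTb.
have [->|a0] := eqVneq a 0; first by rewrite normr0 mul0r opnorm_ge0.
rewrite -ler_pdivlMl ?normr_gt0// -normfV.
have {1}-> : T = a^-1 *: (a *: T) by rewrite scalerA mulVf// scale1r.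
exact: opnormZ_le.
Qed.

Let opnorm0_eq0 (T : bounded_op) : opnorm_on setT T = 0 -> T = 0.
Proof.
move=> T0; apply/val_inj/funext => x /=; apply/normr0_eq0/eqP.
by rewrite eq_le normr_ge0 andbT (le_trans (le_opnorm T x))// T0 mul0r.
Qed.

HB.instance Definition _ := Lmodule_isNormed.Build R[i] bounded_op
  opnormD opnormZ opnorm0_eq0.

End BoundedOperators.

Notation "''B' ( H )" := (bounded_op H) (format "''B' ( H )") : type_scope.

Section Classes.
Context (R : realType) (H : hilbertType R).
Implicit Types (S T : 'B(H)) (L : set H).

(* T^* y is the unique z with <T x, y> = <x, z> for all x; it exists by the
   Riesz representation theorem, so the default value 0 is never used. *)
Definition adjoint T : H -> H :=
  fun y => xget 0 [set z | forall x, inner (T x) y = inner x z].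

Definition closed_subspace L : Prop := submod_closed (mem L) /\ closed L.

Definition absolutely_norm_attaining T : Prop :=
  forall L, closed_subspace L -> L <> [set 0] ->
    exists2 x, L x /\ `|x| = 1 & `|T x| = opnorm_on L T.

Definition star_paranormal T : Prop :=
  forall x, `|adjoint T x| ^+ 2 <= `|T (T x)| * `|x|.

Definition invertible T : Prop :=
  exists S : 'B(H), cancel T S /\ cancel S T.

Definition normal T : Prop := adjoint T \o T = T \o adjoint T.

End Classes.

(* Main.v *)
(* An eigenvector v of a star-paranormal T satisfies T^* v = conj(c) v, so the
   orthogonal complement W of all eigenvectors reduces T, and it suffices to
   show that T is a multiple of an isometry on W.  Operators in the closure of
   AN(H) satisfy T^*T = alpha^2 + compact.  Hence any part of T on which
   |T x| = rho |x| with rho <> alpha is finite-dimensional and, when invariant,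
   contains an eigenvector; none lies inside W.  Star-paranormality also gives
   |T y|^3 <= |T^3 y| |y|^2.

   If the norm of T on W exceeds alpha, it is attained, and by the cubic
   inequality the vectors where it is attained form an invariant subspace of
   this kind.  So |T y| <= alpha |y| on W.  For the lower bound, the cubic
   inequality says that |T^2 y| |T y| / |y|^2 is nondecreasing along orbits.  If
   its infimum on W is less than alpha^3, take nearly minimising vectors, move
   them backwards along their orbits with T^-1, and pass to a weak limit z: the
   ratio is constant along the orbit of z, which forces |T^n z| = rho^n |z| with
   rho < alpha.  The vectors of W growing at most like rho^n again form an
   invariant subspace on which |T x| = rho |x|. *)
Require Import Defs.
From mathcomp Require Import all_boot all_order all_algebra.
From mathcomp Require Import sesquilinear complex ring lra.
From mathcomp Require Import all_classical all_reals all_analysis.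
Import Order.TTheory GRing.Theory Num.Theory.
Import numFieldNormedType.Exports.
Set Implicit Arguments.
Unset Strict Implicit.
Unset Printing Implicit Defensive.
Local Open Scope classical_set_scope.
Local Open Scope ring_scope.
Local Open Scope complex_scope.

(** First-order condition at a minimum: for small [t] the linear term decides the sign. *)
Lemma quadratic_ge0_linear0 (F : realFieldType) (b q : F) :
  (forall t : F, 0 <= 2 * t * b + t ^+ 2 * q) -> b = 0.
Proof.
move=> h; pose M := 1 + `|q|.
have M0 : 0 < M by rewrite ltr_pwDl.
have qM : q <= M by rewrite (le_trans (ler_norm q)) // lerDr.
have := h (- b / M); rewrite -(pmulr_rge0 _ (exprn_gt0 2 M0)).
have -> : M ^+ 2 * (2 * (- b / M) * b + (- b / M) ^+ 2 * q) =
  - (b ^+ 2 * (2 * M - q)) by field; rewrite gt_eqF.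
rewrite oppr_ge0 pmulr_lle0; last by lra.
by move=> h2; apply/eqP; rewrite -sqrf_eq0 eq_le h2 sqr_ge0.
Qed.

(** * Real-valued norm and inner product *)

Section RealHilbert.
Context (R : realType) (H : hilbertType R).
Implicit Types (x y z : H) (r : R) (a : R[i]).

(** Norm and inner product take values in [R[i]]; these real versions give access to real limits,
    [lra] and [nra]. *)
Definition nrm x : R := complex.Re `|x|.
Definition rdot x y : R := complex.Re (inner x y).

Lemma nrmE x : `|x| = (nrm x)%:C.
Proof. by rewrite RRe_real // ger0_real. Qed.

Lemma nrm_ge0 x : 0 <= nrm x.
Proof. by rewrite -ler0c -nrmE. Qed.

Lemma nrm_eq0 x : (nrm x == 0) = (x == 0).
Proof. by rewrite -(normr_eq0 x) nrmE eq_complex /= eqxx andbT. Qed.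

Lemma nrm_gt0 x : (0 < nrm x) = (x != 0).
Proof. by rewrite lt_neqAle nrm_ge0 andbT eq_sym nrm_eq0. Qed.

Lemma nrm0 : nrm (0 : H) = 0.
Proof. by apply/eqP; rewrite nrm_eq0. Qed.

Lemma nrmD x y : nrm (x + y) <= nrm x + nrm y.
Proof. by have := ler_normD x y; rewrite !nrmE -rmorphD lecR. Qed.

Lemma nrmN x : nrm (- x) = nrm x.
Proof. by rewrite /nrm normrN. Qed.

Lemma nrmB x y : nrm (x - y) = nrm (y - x).
Proof. by rewrite -nrmN opprB. Qed.

Lemma nrmZ a x : nrm (a *: x) = complex.Re `|a| * nrm x.
Proof.
by rewrite /nrm normrZ nrmE; case: `|a| => u v /=; rewrite mulr0 subr0.
Qed.

Lemma normcR r : complex.Re `|r%:C| = `|r|.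
Proof. by rewrite normc_def /= expr0n addr0 sqrtr_sqr. Qed.

Lemma nrmZr r x : nrm (r%:C *: x) = `|r| * nrm x.
Proof. by rewrite nrmZ normcR. Qed.

Lemma innerC x y : inner x y = (inner y x)^*%R.
Proof. by rewrite [LHS]hermC expr0 mul1r. Qed.

Lemma innerDl x y z : inner (x + y) z = inner x z + inner y z.
Proof. by rewrite linearDl. Qed.

Lemma innerDr x y z : inner x (y + z) = inner x y + inner x z.
Proof. by rewrite linearDr. Qed.

Lemma innerBl x y z : inner (x - y) z = inner x z - inner y z.
Proof. by rewrite linearBl. Qed.

Lemma innerBr x y z : inner x (y - z) = inner x y - inner x z.
Proof. by rewrite linearBr. Qed.

Lemma innerZl a x y : inner (a *: x) y = a * inner x y.
Proof. by rewrite linearZl_LR. Qed.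

Lemma innerZr a x y : inner x (a *: y) = a^*%R * inner x y.
Proof. by rewrite innerC innerZl rmorphM [in RHS]innerC. Qed.

Lemma inner0l x : inner 0 x = 0.
Proof. by rewrite linear0l. Qed.

Lemma inner0r x : inner x 0 = 0.
Proof. by rewrite linear0r. Qed.

Lemma rdotC x y : rdot x y = rdot y x.
Proof. by rewrite /rdot innerC; case: (inner y x). Qed.

Lemma rdotDl x y z : rdot (x + y) z = rdot x z + rdot y z.
Proof. by rewrite /rdot innerDl raddfD. Qed.

Lemma rdotDr x y z : rdot x (y + z) = rdot x y + rdot x z.
Proof. by rewrite rdotC rdotDl !(rdotC x). Qed.

Lemma rdotBl x y z : rdot (x - y) z = rdot x z - rdot y z.
Proof. by rewrite /rdot innerBl raddfB. Qed.

Lemma rdotBr x y z : rdot x (y - z) = rdot x y - rdot x z.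
Proof. by rewrite rdotC rdotBl !(rdotC x). Qed.

Lemma rdotZl r x y : rdot (r%:C *: x) y = r * rdot x y.
Proof. by rewrite /rdot innerZl; case: (inner x y) => u v /=; rewrite mul0r subr0. Qed.

Lemma rdotZr r x y : rdot x (r%:C *: y) = r * rdot x y.
Proof. by rewrite rdotC rdotZl rdotC. Qed.

Lemma rdotxx x : rdot x x = nrm x ^+ 2.
Proof. by apply: (@complexI R); rewrite /rdot innerxx nrmE -rmorphXn. Qed.

(** Recovers the complex form from its real part, so that facts about [rdot] transfer to [inner]. *)
Lemma inner_rdot x y : inner x y = (rdot x y) +i* (rdot x ('i *: y)).
Proof.
rewrite /rdot innerZr; case: (inner x y) => u v.
by apply/eqP; rewrite eq_complex /= !mul0r !mulN1r opprK add0r !eqxx.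
Qed.

Lemma nrm_sqrD x y : nrm (x + y) ^+ 2 = nrm x ^+ 2 + 2 * rdot x y + nrm y ^+ 2.
Proof. by rewrite -!rdotxx rdotDl !rdotDr (rdotC y x); ring. Qed.

Lemma nrm_sqrB x y : nrm (x - y) ^+ 2 = nrm x ^+ 2 - 2 * rdot x y + nrm y ^+ 2.
Proof. by rewrite -!rdotxx rdotBl !rdotBr (rdotC y x); ring. Qed.

Lemma rdotNl x y : rdot (- x) y = - rdot x y.
Proof. by rewrite -sub0r rdotBl -[X in X - _](_ : 0 = _) ?sub0r // /rdot inner0l. Qed.

(** Cauchy-Schwarz, read off the square of the triangle inequality. *)
Lemma rdot_le x y : `|rdot x y| <= nrm x * nrm y.
Proof.
suff h u v : rdot u v <= nrm u * nrm v.
  by rewrite ler_norml h andbT lerNl -rdotNl -(nrmN x) h.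
have uv : 0 <= nrm u + nrm v by rewrite addr_ge0 ?nrm_ge0.
have := lerXn2r 2 (nrm_ge0 (u + v)) uv (nrmD u v).
rewrite nrm_sqrD; nra.
Qed.

End RealHilbert.

(** * Riesz representation of real-linear functionals *)

Section Riesz.
Context (R : realType) (H : hilbertType R).
Implicit Types (x y z : H) (r : R).

Lemma complex_gt0 (e : R[i]) : 0 < e -> exists2 r : R, 0 < r & e = r%:C.
Proof.
case: e => u v; rewrite ltcE /= => /andP[/eqP v0 u0].
by exists u => //; rewrite v0.
Qed.

Lemma nrm_cauchy_cvg (u : nat -> H) :
  (forall e : R, 0 < e -> exists N, forall m n, (N <= m)%N -> (N <= n)%N ->
     nrm (u m - u n) < e) ->
  exists z, (fun n => nrm (u n - z)) @ \oo --> (0 : R).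
Proof.
move=> cu.
have /cauchy_cvg : cauchy (u @ \oo).
  apply: cauchy_exP => e /complex_gt0[r r0 ->].
  have [N hN] := cu r r0; exists (u N); exists N => // n /= Nn.
  by rewrite -ball_normE /= nrmE ltcR; apply: hN.
move=> cvu; exists (lim (u @ \oo)).
apply/cvgrPdist_lt => e e0.
have e0' : 0 < e%:C :> R[i] by rewrite ltcR.
move/cvgrPdist_lt: cvu => /(_ _ e0'); apply: filterS => n.
by rewrite nrmE ltcR nrmB sub0r normrN ger0_norm ?nrm_ge0.
Qed.

Lemma rdot_cvg (T : Type) (F : set_system T) (FF : Filter F) (u : T -> H) z y :
  (fun n => nrm (u n - z)) @ F --> (0 : R) ->
  (fun n => rdot (u n) y) @ F --> rdot z y.
Proof.
move=> uz; apply/cvgrPdist_lt => e e0.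
have N0 : 0 < nrm y + 1 by rewrite ltr_wpDl ?nrm_ge0.
have h0 : 0 < e / (nrm y + 1) by rewrite divr_gt0.
move/cvgrPdist_lt: uz => /(_ _ h0); apply: filterS => n.
rewrite sub0r normrN ger0_norm ?nrm_ge0 // ltr_pdivlMr // => h.
rewrite -rdotBl (le_lt_trans (rdot_le _ _)) // nrmB (le_lt_trans _ h) //.
by rewrite ler_wpM2l ?nrm_ge0 // lerDl.
Qed.

(** The representing vector minimises [J]: a minimising sequence is Cauchy, and the first variation
    vanishes at its limit. *)
Lemma riesz (l : H -> R) (C : R) : {morph l : x y / x + y} ->
  (forall r x, l (r%:C *: x) = r * l x) -> (forall x, l x <= C * nrm x) ->
  exists z, forall y, rdot z y = l y.
Proof.
move=> lD lZ lC; pose J x := nrm x ^+ 2 - 2 * l x.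
have Jlb x : - C ^+ 2 <= J x.
  rewrite /J; have := lC x; have := sqr_ge0 (nrm x - C); nra.
have infJ : has_inf (range J).
  by split; [exists (J 0), 0|exists (- C ^+ 2) => _ [x _ <-]].
have Jinf x : inf (range J) <= J x by apply: (ge_inf infJ.2); exists x.
have /choice[u uJ] : forall n : nat, exists x, J x < inf (range J) + n.+1%:R^-1.
  move=> n; have n0 : 0 < n.+1%:R^-1 :> R by rewrite invr_gt0.
  by have [_ [x _ <-] hx] := inf_adherent n0 infJ; exists x.
have JD x y t : J (x + t%:C *: y) =
    J x + 2 * t * (rdot x y - l y) + t ^+ 2 * nrm y ^+ 2.
  rewrite /J lD lZ nrm_sqrD rdotZr nrmZr exprMn -normrX ger0_norm ?sqr_ge0 //.
  ring.
have cau : forall e : R, 0 < e -> exists N, forall m n, (N <= m)%N -> (N <= n)%N ->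
    nrm (u m - u n) < e.
  move=> e e0; pose d := e ^+ 2 / 4; have d0 : 0 < d by rewrite divr_gt0 ?exprn_gt0.
  have [N _ hN] := near_infty_natSinv_lt (PosNum d0).
  exists N => m n Nm Nn.
  have hm := hN m Nm; have hn := hN n Nn; rewrite /= in hm hn.
  rewrite -(ltr_pXn2r (n := 2)) ?nnegrE ?nrm_ge0 ?(ltW e0) //.
  (* At the midpoint [J] is the mean of its end values minus a quarter of the squared distance;
     staying above the infimum forces that square below [4 * d = e ^+ 2]. *)
  have := Jinf (u m + (1/2)%:C *: (u n - u m)); rewrite JD nrmB.
  have := JD (u m) (u n - u m) 1; rewrite [1%:C *: _]scale1r (addrC (u m)) subrK.
  rewrite nrmB; have := uJ m; have := uJ n; rewrite /d in hm hn.
  set N2 := nrm (u m - u n) ^+ 2; set X := rdot _ _ - l _.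
  have -> : (1 / 2 : R) ^+ 2 = 1 / 4 by field.
  move: N2 X hm hn => N2 X; rewrite expr1n.
  move: (J (u n)) (J (u m)) (inf _) (n.+1%:R^-1) (m.+1%:R^-1) (e ^+ 2) => a b c p q s.
  lra.
have [z uz] := nrm_cauchy_cvg cau; exists z => y.
apply/eqP; rewrite -subr_eq0; apply/eqP.
apply: (@quadratic_ge0_linear0 _ _ (nrm y ^+ 2)) => t.
(* Moving from [u n] by [t *: y] lowers [J] by less than [n.+1%:R^-1]; in the limit the quadratic in
   [t] is nonnegative. *)
have cv : (fun n : nat => n.+1%:R^-1 + (2 * t * (rdot (u n) y - l y) + t ^+ 2 * nrm y ^+ 2))
    @ \oo --> 0 + (2 * t * (rdot z y - l y) + t ^+ 2 * nrm y ^+ 2).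
  apply: cvgD; first exact: cvg_harmonic.
  apply: cvgD; last exact: cvg_cst.
  apply: cvgM; first exact: cvg_cst.
  apply: cvgB; last exact: cvg_cst.
  exact: rdot_cvg uz.
rewrite -[leRHS]add0r; apply: (cvgr_to_ge cv); near=> n.
have := uJ n; have := Jinf (u n + t%:C *: y); rewrite JD -addrA.
move: (2 * t * _ + _) (inf _) (J (u n)) (n.+1%:R^-1) => a b c d; lra.
Unshelve. all: by end_near. Qed.

End Riesz.

(** * Existence of the adjoint *)

Section Adjoint.
Context (R : realType) (H : hilbertType R).
Implicit Types (x y z : H) (T : 'B(H)).

Lemma bounded_op_nrm T : exists2 M : R, 0 < M & forall x, nrm (T x) <= M * nrm x.
Proof.
have [M TM] := bounded_opP T; exists (`|M| + 1); first by rewrite ltr_wpDl.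
move=> x; have := TM x; rewrite !nrmE -rmorphM lecR => /le_trans -> //.
by rewrite ler_wpM2r ?nrm_ge0 // (le_trans (ler_norm M)) // lerDl.
Qed.

(** Riesz represents the real part only; evaluating it at ['i *: x] as well gives the imaginary
    part. *)
Lemma adjointE T x y : inner (T x) y = inner x (adjoint T y).
Proof.
have [M M0 TM] := bounded_op_nrm T.
have [|r x'|x'|z zP] := @riesz _ _ (fun x => rdot (T x) y) (M * nrm y).
- by move=> x1 x2; rewrite linearD rdotDl.
- by rewrite linearZ rdotZl.
- rewrite (le_trans (ler_norm _)) // (le_trans (rdot_le _ _)) // mulrAC.
  by rewrite ler_wpM2r ?nrm_ge0.
have ex : [set z | forall x, inner (T x) y = inner x z] z.
  move=> x'; rewrite /= innerC [RHS]innerC; congr (_^*%R).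
  by rewrite !inner_rdot !zP linearZ !(rdotC y).
by rewrite /adjoint; case: xgetP => [w _ ->|/(_ z)].
Qed.

Lemma adjointEr T x y : inner x (T y) = inner (adjoint T x) y.
Proof. by rewrite innerC adjointE -innerC. Qed.

Lemma rdot_adjoint T x y : rdot (T x) y = rdot x (adjoint T y).
Proof. by rewrite /rdot adjointE. Qed.

End Adjoint.

(** * Subspaces of finite codimension *)

Section FiniteCodimension.
Context (R : realType) (H : hilbertType R).
Implicit Types (x y z : H) (fs : seq H).

Definition orth fs : set H := [set x | forall f, f \in fs -> inner x f = 0].

Lemma orth_cat fs gs x : orth (fs ++ gs) x -> orth fs x /\ orth gs x.
Proof. by move=> o; split=> f fi; apply: o; rewrite mem_cat fi ?orbT. Qed.

(** The sum is a finite-rank correction of [w]. A new [f] is either orthogonal to [orth fs] already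
    or costs one more rank-one term, along some [u] in [orth fs] with [inner u f = 1]. *)
Lemma orth_decomp fs : exists P : seq (H * H), forall w,
  orth fs (w - \sum_(p <- P) inner w p.1 *: p.2).
Proof.
elim: fs => [|f fs [P hP]]; first by exists [::] => w f.
have [h|/existsNP[u0 /not_implyP[u0P u0f]]] := pselect (forall u, orth fs u -> inner u f = 0).
  exists P => w g; rewrite inE => /predU1P[->|]; [exact: h (hP w)|exact: hP].
pose u := (inner u0 f)^-1 *: u0.
have uf : inner u f = 1 by rewrite /u innerZl mulVf //; apply/eqP.
have uP : orth fs u by move=> g gi; rewrite /u innerZl (u0P g gi) mulr0.
(* Chosen so that [inner w g] pairs [f] with [w] after the earlier correction. *)
pose g := f - \sum_(p <- P) (inner p.2 f)^*%R *: p.1.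
exists ((g, u) :: P) => w g'; rewrite big_cons /= opprD addrCA addrC.
have -> : inner w g = inner (w - \sum_(p <- P) inner w p.1 *: p.2) f.
  rewrite innerBl innerBr; congr (_ - _).
  elim: P {hP g} => [|p P IH]; first by rewrite !big_nil inner0l inner0r.
  by rewrite !big_cons innerDl innerDr IH innerZl innerZr conjCK mulrC.
set q := w - _; rewrite inE => /predU1P[->|gi].
  by rewrite innerBl innerZl uf mulr1 subrr.
by rewrite innerBl innerZl (uP g' gi) mulr0 subr0; exact: hP gi.
Qed.

(** Otherwise every vector equals its finite-rank correction, and finitely many vectors span [H]. *)
Lemma orth_nontrivial fs : infinite_dimensional H -> exists2 x, orth fs x & x != 0.
Proof.
move=> infH; apply: contrapT => h; apply: infH.
have [P hP] := orth_decomp fs.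
exists (size P), (fun i => (nth (0, 0) P i).2) => x.
exists (fun i => inner x (nth (0, 0) P i).1).
rewrite -(big_mkord xpredT (fun i => inner x (nth (0, 0) P i).1 *: (nth (0, 0) P i).2)).
rewrite -(big_nth (0, 0) xpredT (fun p => inner x p.1 *: p.2)).
apply/eqP; rewrite -subr_eq0; apply/negPn/negP => n0; apply: h.
by exists (x - \sum_(p <- P) inner x p.1 *: p.2).
Qed.

End FiniteCodimension.

(** * Essential bounds of absolutely norm attaining operators *)

Section EssentialNorm.
Context (R : realType) (H : hilbertType R).
Implicit Types (x y z : H) (fs : seq H) (S T : 'B(H)).

Lemma opnorm_on_ge T (L : set H) x : (forall r : R, forall y, L y -> L (r%:C *: y)) ->
  L x -> nrm (T x) <= complex.Re (opnorm_on L T) * nrm x.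
Proof.
move=> LZ Lx; rewrite /opnorm_on /=.
have [->|x0] := eqVneq x 0; first by rewrite linear0 !nrm0 mulr0.
have nx0 : 0 < nrm x by rewrite nrm_gt0.
rewrite -ler_pdivrMr // -[nrm (T x) / _](_ : nrm (T ((nrm x)^-1%:C *: x)) = _); last first.
  by rewrite linearZ nrmZr mulrC ger0_norm // invr_ge0 ltW.
apply: ub_le_sup; last first.
  exists ((nrm x)^-1%:C *: x) => //; split; first exact: LZ.
  rewrite /= nrmE -[leRHS]/(1%:C) lecR nrmZr ger0_norm ?invr_ge0 ?nrm_ge0 //.
  by rewrite mulVf // gt_eqF.
have [M M0 TM] := bounded_op_nrm T; exists M => _ [y [_ /= y1] <-].
move: y1; rewrite nrmE -[leRHS]/(1%:C) lecR => y1; rewrite (le_trans (TM y)) //.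
by rewrite ler_piMr // ltW.
Qed.

(* A point where T attains its norm on L is critical for s^2 |y|^2 - |T y|^2. *)
Lemma norm_attained_critical T (L : set H) (s : R) x :
  (forall r : R, forall y z, L y -> L z -> L (y + r%:C *: z)) ->
  (forall y, L y -> nrm (T y) <= s * nrm y) ->
  L x -> nrm (T x) = s * nrm x ->
  forall y, L y -> rdot (T x) (T y) = s ^+ 2 * rdot x y.
Proof.
move=> LD Ls Lx Tx y Ly; apply/eqP; rewrite eq_sym -subr_eq0; apply/eqP.
apply: (@quadratic_ge0_linear0 _ _ (s ^+ 2 * nrm y ^+ 2 - nrm (T y) ^+ 2)) => t.
have := Ls _ (LD t _ _ Lx Ly).
have h := lerXn2r 2 (nrm_ge0 _) (le_trans (nrm_ge0 _) (Ls _ (LD t _ _ Lx Ly))).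
move=> /h; rewrite exprMn linearD linearZ !nrm_sqrD !rdotZr !nrmZr !exprMn.
rewrite Tx -normrX ger0_norm ?sqr_ge0 // exprMn.
move: (nrm x ^+ 2) (nrm y ^+ 2) (nrm (T y) ^+ 2) (rdot (T x) (T y)) (rdot x y).
by move=> a b c d e; rewrite -subr_ge0 => /le_trans; apply; lra.
Qed.

(** The double orthogonal complement is the closed span of the [u n], in a form that needs no
    series. *)
Lemma closed_double_orth (u : nat -> H) : closed_subspace
  [set x | forall y, (forall n, inner (u n) y = 0) -> inner x y = 0].
Proof.
split.
  split=> [|a x y]; rewrite !inE /=; first by move=> y _; rewrite inner0l.
  by move=> hx hy z hz; rewrite innerDl innerZl (hx z) // (hy z) // mulr0 addr0.
move=> x cx y hy.
have real0 z : (forall n, inner (u n) z = 0) -> rdot x z = 0.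
  move=> hz; apply/eqP; rewrite -normr_eq0; apply/negPn/negP => n0.
  have n0' : 0 < `|rdot x z| by rewrite lt_neqAle eq_sym n0 normr_ge0.
  have z1 : 0 < nrm z + 1 by rewrite ltr_wpDl ?nrm_ge0.
  (* A point [w] of the set this close to [x] would make [rdot x z = rdot (x - w) z] smaller than
     itself in absolute value. *)
  have e0 : 0 < (`|rdot x z| / (nrm z + 1))%:C :> R[i] by rewrite ltcR divr_gt0.
  have [w [/= Lw]] := cx _ (nbhsx_ballx x _ e0).
  rewrite -ball_normE /= nrmE ltcR ltr_pdivlMr //; apply/negP; rewrite -leNgt.
  have -> : rdot x z = rdot (x - w) z by rewrite rdotBl [rdot w z]/rdot (Lw z) // subr0.
  rewrite (le_trans (rdot_le _ _)) // ler_wpM2l ?nrm_ge0 // lerDl //.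
rewrite inner_rdot !real0 // => n; by rewrite innerZr hy mulr0.
Qed.

(** Says that the essential norm of [T] does not exceed its essential minimum modulus; the gap
    between [a] and [b] makes this stable under norm limits. *)
Definition ess_dichotomy T := forall a b : R, 0 <= a -> a < b ->
  (exists fs, forall x, orth fs x -> a * nrm x <= nrm (T x)) \/
  (exists fs, forall x, orth fs x -> nrm (T x) <= b * nrm x).

(* If the dichotomy fails there is an orthonormal sequence u_n whose images
   stay orthogonal and have strictly increasing norms: the norm is not
   attained on the closed span of the u_n. *)
Lemma absolutely_norm_attaining_dichotomy T :
  absolutely_norm_attaining T -> ess_dichotomy T.
Proof.
move=> AN a b a0 ab; apply: contrapT => /not_orP[na nb].
have ha fs : exists2 x, orth fs x & nrm (T x) < a * nrm x.
  apply: contrapT => h; apply: na; exists fs => x ox.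
  by rewrite leNgt; apply/negP => h2; apply: h; exists x.
have hb fs : exists2 x, orth fs x & b * nrm x < nrm (T x).
  apply: contrapT => h; apply: nb; exists fs => x ox.
  by rewrite leNgt; apply/negP => h2; apply: h; exists x.
have a2b2 : a ^+ 2 < b ^+ 2 by rewrite ltr_pXn2r // nnegrE // ltW // (le_lt_trans a0).
(* The quotient of [e] is too small and that of [f] too large. As [f] is orthogonal to [e] and to
   [adjoint T (T e)], cross terms vanish and a combination hits [c] exactly. *)
have step fs (c : R) : a ^+ 2 <= c -> c < b ^+ 2 ->
    exists u, [/\ orth fs u, nrm u = 1 & nrm (T u) ^+ 2 = c].
  move=> ac cb; have [e oe Te] := ha fs.
  have [f of' Tf] := hb (e :: adjoint T (T e) :: fs).
  have e0 : 0 < nrm e.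
    rewrite nrm_gt0; apply/eqP => e0; move: Te; rewrite e0 linear0 nrm0 mulr0.
    by rewrite ltxx.
  have f0 : 0 < nrm f.
    rewrite nrm_gt0; apply/eqP => f0; move: Tf; rewrite f0 linear0 nrm0 mulr0.
    by rewrite ltxx.
  have fe : rdot f e = 0 by rewrite /rdot (of' e) // inE eqxx.
  have Tfe : rdot (T f) (T e) = 0.
    by rewrite rdot_adjoint /rdot (of' (adjoint T (T e))) // !inE eqxx orbT.
  pose A := (nrm (T e) / nrm e) ^+ 2; pose B := (nrm (T f) / nrm f) ^+ 2.
  have Aa : A < c.
    rewrite (lt_le_trans _ ac) // ltr_pXn2r ?nnegrE ?divr_ge0 ?nrm_ge0 //.
    by rewrite ltr_pdivrMr.
  have Bb : c < B.
    rewrite (lt_trans cb) // ltr_pXn2r ?nnegrE ?divr_ge0 ?nrm_ge0 //.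
      by rewrite ltr_pdivlMr.
    by rewrite ltW // (le_lt_trans a0).
  have BA : 0 < B - A by rewrite subr_gt0 (lt_trans Aa).
  (* The squared lengths of the two components are the weights that average [A] and [B] to [c]. *)
  pose s := Num.sqrt ((B - c) / (B - A)) / nrm e.
  pose t := Num.sqrt ((c - A) / (B - A)) / nrm f.
  have s2 : s ^+ 2 * nrm e ^+ 2 = (B - c) / (B - A).
    rewrite -exprMn divfK ?gt_eqF // sqr_sqrtr // divr_ge0 // ltW //.
    by rewrite subr_gt0.
  have t2 : t ^+ 2 * nrm f ^+ 2 = (c - A) / (B - A).
    rewrite -exprMn divfK ?gt_eqF // sqr_sqrtr // divr_ge0 // ltW //.
    by rewrite subr_gt0.
  have s2' : s ^+ 2 * nrm (T e) ^+ 2 = (B - c) / (B - A) * A.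
    by rewrite -s2 /A; field; rewrite gt_eqF.
  have t2' : t ^+ 2 * nrm (T f) ^+ 2 = (c - A) / (B - A) * B.
    by rewrite -t2 /B; field; rewrite gt_eqF.
  exists (s%:C *: e + t%:C *: f); split.
  - by move=> g gi; rewrite innerDl !innerZl (oe g gi) (of' g) ?mulr0 ?addr0 // !inE gi !orbT.
  - apply/eqP; rewrite -[_ == _](@eqrXn2 _ 2 _ 1) ?nrm_ge0 //; apply/eqP.
    rewrite nrm_sqrD rdotZl rdotZr (rdotC e) fe !nrmZr !exprMn -!normrX.
    rewrite !(ger0_norm (sqr_ge0 _)) s2 t2; field; by rewrite gt_eqF.
  - rewrite linearD !linearZ nrm_sqrD rdotZl rdotZr (rdotC (T e)) Tfe !nrmZr !exprMn -!normrX.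
    rewrite !(ger0_norm (sqr_ge0 _)) s2' t2'; field; by rewrite gt_eqF.
pose c (n : nat) : R := b ^+ 2 - (b ^+ 2 - a ^+ 2) / n.+1%:R.
have d0 : 0 < b ^+ 2 - a ^+ 2 by rewrite subr_gt0.
have ac n : a ^+ 2 <= c n.
  by rewrite /c lerBrDl -lerBrDr ler_pdivrMr // ler_peMr ?ler1n // ltW.
have cb n : c n < b ^+ 2 by rewrite /c ltrBlDr ltrDl divr_gt0.
have cS n : c n < c n.+1.
  by rewrite /c ltrD2l ltrN2 ltr_pM2l // ltf_pV2 ?posrE // ltr_nat.
have /choice[nxt nxtP] : forall p : seq H * nat, exists u,
    [/\ orth p.1 u, nrm u = 1 & nrm (T u) ^+ 2 = c p.2].
  by move=> p; apply: step.
(* Keeping [adjoint T (T u)] beside [u] makes later images orthogonal to [T u]. *)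
pose hist := fix hist n := if n is m.+1 then
  let u := nxt (hist m, m) in u :: adjoint T (T u) :: hist m else [::].
pose u n := nxt (hist n, n).
have histP i n : (i < n)%N -> u i \in hist n /\ adjoint T (T (u i)) \in hist n.
  elim: n => // n IH; rewrite ltnS leq_eqVlt => /predU1P[->|/IH[h1 h2]].
    by rewrite /= !inE !eqxx orbT.
  by rewrite /= !inE h1 h2 !orbT.
have u1 n : nrm (u n) = 1 by have [] := nxtP (hist n, n).
have Tu n : nrm (T (u n)) ^+ 2 = c n by have [] := nxtP (hist n, n).
have uu i j : i != j -> inner (u i) (u j) = 0 /\ inner (T (u i)) (T (u j)) = 0.
  wlog ij : i j / (j < i)%N => [hw|_].
    move=> nij; have := nij; rewrite neq_ltn => /orP[ij|ji]; last exact: hw.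
    have [|h1 h2] := hw j i ij; first by rewrite eq_sym.
    by rewrite innerC h1 innerC h2 conjC0.
  have [ou _ _] := nxtP (hist i, i); have [h1 h2] := histP _ _ ij.
  by rewrite adjointE (ou _ h1) (ou _ h2).
pose L := [set x | forall y, (forall n, inner (u n) y = 0) -> inner x y = 0].
have cL : closed_subspace L := closed_double_orth u.
have LD (r : R[i]) y z : L y -> L z -> L (y + r *: z).
  by move=> Ly Lz w hw; rewrite innerDl innerZl (Ly w) // (Lz w) // mulr0 addr0.
have L0 : L 0 by move=> y _; rewrite inner0l.
have LZ (r : R[i]) y : L y -> L (r *: y) by rewrite -[r *: y]add0r; exact: LD.
have Lu n : L (u n) by move=> y /(_ n).
have [|x [Lx x1] Tx] := AN L cL.
  move=> L1; have := Lu 0%N; rewrite L1 /= => h; have := u1 0%N.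
  by rewrite h nrm0 => /esym/eqP; rewrite oner_eq0.
pose s := complex.Re (opnorm_on L T).
have Ls y : L y -> nrm (T y) <= s * nrm y.
  by move=> Ly; apply: opnorm_on_ge => // r z; exact: LZ.
have x1' : nrm x = 1 by rewrite /nrm x1.
have Txs : nrm (T x) = s * nrm x by rewrite x1' mulr1 /s -Tx.
have s0 : 0 <= s.
  by have := le_trans (nrm_ge0 _) (Ls _ (Lu 0%N)); rewrite u1 mulr1.
have sc n : c n < s ^+ 2.
  rewrite (lt_le_trans (cS n)) // -Tu lerXn2r ?nnegrE ?nrm_ge0 //.
  by have := Ls _ (Lu n.+1); rewrite u1 mulr1.
(* The vector [adjoint T (T (u n)) - (c n)%:C *: u n] is orthogonal to every [u m], hence to [x].
   With [x] critical, [c n] and [s ^+ 2] have equal products with [rdot x (r *: u n)], which is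
   therefore zero. *)
have xu n (r : R[i]) : rdot x (r *: u n) = 0.
  have h := norm_attained_critical (fun r => LD r%:C) Ls Lx Txs (LZ r _ (Lu n)).
  have : inner x (adjoint T (T (r *: u n)) - (c n)%:C *: (r *: u n)) = 0.
    apply: Lx => m; rewrite innerBr -adjointE linearZ !innerZr.
    have [->|mn] := eqVneq m n; last by have [-> ->] := uu _ _ mn; rewrite !mulr0 subrr.
    rewrite !innerxx !nrmE u1 -rmorphXn Tu expr1n mulr1.
    by rewrite (conjc_real (c n) : (c n)%:C^*%R = _) mulrC subrr.
  move/(congr1 (@complex.Re R)); rewrite -[LHS]/(rdot _ _) rdotBr -rdot_adjoint h rdotZr /=.
  move/eqP; rewrite -mulrBl mulf_eq0 subr_eq0 gt_eqF ?sc //.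
  by move/eqP.
have : inner x x = 0.
  apply: Lx => n; rewrite innerC inner_rdot xu.
  by have := xu n 1; rewrite scale1r => ->; rewrite conjC0.
by rewrite innerxx x1 expr1n => /eqP; rewrite oner_eq0.
Qed.

End EssentialNorm.

(** * The essential scalar of operators in the closure *)

Section EssentialScalar.
Context (R : realType) (H : hilbertType R).
Implicit Types (x y z : H) (fs : seq H) (S T : 'B(H)).

(** A perturbation of norm below [d] shifts each bound by at most [d]; a third of the gap leaves
    room for both shifts. *)
Lemma closure_dichotomy T :
  closure [set S : 'B(H) | absolutely_norm_attaining S] T -> ess_dichotomy T.
Proof.
move=> cT a b a0 ab; pose d := (b - a) / 3.
have d0 : 0 < d by rewrite divr_gt0 // subr_gt0.
have d0' : 0 < d%:C :> R[i] by rewrite ltcR.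
have [S [/= ANS]] := cT _ (nbhsx_ballx T _ d0').
rewrite -ball_normE /= => TS.
have TSx x : nrm (T x - S x) <= d * nrm x.
  have := le_trans (le_opnorm (T - S) x) (ler_wpM2r (normr_ge0 x) (ltW TS)).
  by rewrite !nrmE -rmorphM lecR.
have ad : 0 <= a + d by rewrite addr_ge0 // ltW.
have adb : a + d < b - d by rewrite /d; lra.
have [[fs hfs]|[fs hfs]] := absolutely_norm_attaining_dichotomy ANS ad adb.
  left; exists fs => x /hfs h; have := TSx x; have := nrmD (S x - T x) (T x).
  by rewrite subrK nrmB; lra.
right; exists fs => x /hfs h; have := TSx x; have := nrmD (T x - S x) (S x).
by rewrite subrK; lra.
Qed.

(* T^*T - alpha^2 is compact, expressed through its quadratic form. *)
Definition ess_scalar T (alpha : R) := forall e : R, 0 < e -> exists fs, forall x,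
  orth fs x -> `|nrm (T x) ^+ 2 - alpha ^+ 2 * nrm x ^+ 2| <= e * nrm x ^+ 2.

(** Here [alpha] is the essential minimum modulus; the dichotomy turns it into an essential upper
    bound as well. *)
Lemma ess_dichotomy_scalar T : infinite_dimensional H -> ess_dichotomy T ->
  exists2 alpha : R, 0 <= alpha & ess_scalar T alpha.
Proof.
move=> infH dT; have [M M0 TM] := bounded_op_nrm T.
pose A := [set a : R | 0 <= a /\ exists fs, forall x, orth fs x -> a * nrm x <= nrm (T x)].
have A0 : A 0 by split=> //; exists [::] => x _; rewrite mul0r nrm_ge0.
have AM : has_sup A.
  split; first by exists 0.
  (* Infinite dimension enters here: a nonzero vector of [orth fs] caps [a] by [M]. *)
  exists M => a [_ [fs hfs]]; have [x ox x0] := orth_nontrivial fs infH.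
  by have := le_trans (hfs _ ox) (TM x); rewrite ler_pM2r ?nrm_gt0.
pose al := sup A.
have al0 : 0 <= al by apply: ub_le_sup A0; exact: AM.2.
have low d : 0 < d -> exists fs, forall x, orth fs x -> (al - d) * nrm x <= nrm (T x).
  move=> d0; have [a [a0 [fs hfs]] da] := sup_adherent d0 AM.
  exists fs => x /hfs; apply: le_trans; rewrite ler_wpM2r ?nrm_ge0 // ltW //.
have upp d : 0 < d -> exists fs, forall x, orth fs x -> nrm (T x) <= (al + d) * nrm x.
  move=> d0; have d20 : 0 < d / 2 by rewrite divr_gt0.
  have h1 : 0 <= al + d / 2 by rewrite addr_ge0 // ltW.
  have h2 : al + d / 2 < al + d by lra.
  (* The level [al + d / 2] lies above the supremum, which excludes the first alternative. *)
  have [h|//] := dT _ _ h1 h2.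
  have /(ub_le_sup AM.2) : A (al + d / 2) by split.
  by rewrite -/al; lra.
exists al => // e e0; pose d := e / (M + al + 1).
have Mal : 0 < M + al + 1 by lra.
have d0 : 0 < d by rewrite divr_gt0.
have [fs hfs] := low _ d0; have [gs hgs] := upp _ d0.
exists (fs ++ gs) => x /orth_cat[/hfs h1 /hgs h2].
have hd : `|nrm (T x) - al * nrm x| <= d * nrm x.
  by rewrite ler_norml; apply/andP; split; lra.
have -> : nrm (T x) ^+ 2 - al ^+ 2 * nrm x ^+ 2 =
  (nrm (T x) - al * nrm x) * (nrm (T x) + al * nrm x) by ring.
rewrite normrM.
have hs : `|nrm (T x) + al * nrm x| <= (M + al + 1) * nrm x.
  rewrite ger0_norm ?addr_ge0 ?mulr_ge0 ?nrm_ge0 //.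
  by have := TM x; have := nrm_ge0 x; lra.
apply: (le_trans (ler_pM (normr_ge0 _) (normr_ge0 _) hd hs)).
by rewrite mulrACA /d divfK ?gt_eqF // expr2.
Qed.

End EssentialScalar.

(** * Weak limits along an ultrafilter *)

Section WeakLimits.
Context (R : realType) (H : hilbertType R).
Context (U : set_system nat) (ultraU : UltraFilter U).
Implicit Types (x y z : H) (fs : seq H) (S T : 'B(H)) (u w : nat -> H).

Let FU : ProperFilter U := @ultra_proper _ _ ultraU.
Local Existing Instance FU.

Lemma ultra_image_filter (T : Type) (f : nat -> T) : UltraFilter (f @ U).
Proof.
split; first exact: fmap_proper_filter.
move=> G PG sub; apply/seteqP; split=> // A GA.
have [//|UnA] := in_ultra_setVsetC (f @^-1` A) ultraU.
have GnA : G (~` A) by apply: sub.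
have : G set0 by rewrite -(setICr A); exact: filterI.
by move/filter_not_empty.
Qed.

(** Compactness of the interval; ultrafilter limits replace the extraction of subsequences. *)
Lemma ultra_bounded_cvg (f : nat -> R) (M : R) : (forall n, `|f n| <= M) ->
  exists l : R, f @ U --> l.
Proof.
move=> fM; have := @segment_compact R (- M) M; rewrite compact_ultra => /(_ (f @ U)).
case=> [||l [_ fl]]; last by exists l.
  exact: ultra_image_filter.
suff : U (f @^-1` `[- M, M]%classic) by [].
apply: filterS (filterT : U setT) => n _; rewrite /= in_itv /= -ler_norml; exact: fM.
Qed.

(** Real parts suffice, since [y] may be replaced by ['i *: y]. *)
Definition weak_cvg u z := forall y, (fun n => rdot (u n) y) @ U --> rdot z y.

(** The limits of [rdot (u n) y] form a bounded functional of [y], which Riesz represents. *)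
Lemma weak_limit u (M : R) : (forall n, nrm (u n) <= M) -> exists z, weak_cvg u z.
Proof.
move=> uM; have M0 : 0 <= M := le_trans (nrm_ge0 _) (uM 0%N).
have bd y n : `|rdot (u n) y| <= M * nrm y.
  by rewrite (le_trans (rdot_le _ _)) // ler_wpM2r ?nrm_ge0.
have /choice[l lP] : forall y, exists l : R, (fun n => rdot (u n) y) @ U --> l.
  by move=> y; apply: ultra_bounded_cvg (bd y).
have [x y|r x|x|z zP] := @riesz R H l M; last by exists z => y; rewrite zP.
- apply: (cvg_unique (@Rhausdorff R) (lP (x + y))).
  rewrite (_ : (fun n => _) = (fun n => rdot (u n) x + rdot (u n) y)); first exact: cvgD.
  by apply/funext => n; rewrite rdotDr.
- apply: (cvg_unique (@Rhausdorff R) (lP (r%:C *: x))).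
  rewrite (_ : (fun n => _) = (fun n => r * rdot (u n) x)).
    by apply: cvgM => //; exact: cvg_cst.
  by apply/funext => n; rewrite rdotZr.
- apply: (cvgr_to_le (lP x)); apply: nearW => n.
  by rewrite (le_trans (ler_norm _)).
Qed.

Lemma weak_cvg_op T u z : weak_cvg u z -> weak_cvg (T \o u) (T z).
Proof.
move=> uz y; rewrite rdot_adjoint /=; under eq_fun do rewrite rdot_adjoint.
exact: uz.
Qed.

Lemma weak_cvgB u z : weak_cvg u z -> weak_cvg (fun n => u n - z) 0.
Proof.
move=> uz y; under eq_fun do rewrite rdotBl.
have -> : rdot 0 y = rdot z y - rdot z y by rewrite -rdotBl subrr.
apply: cvgB; [exact: uz|exact: cvg_cst].
Qed.

Lemma cvg_squeeze0 (f g : nat -> R) : (forall n, `|f n| <= g n) ->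
  g @ U --> (0 : R) -> f @ U --> (0 : R).
Proof.
move=> fg g0; apply: norm_cvg0; apply: (squeeze_cvgr _ (cvg_cst 0) g0).
by apply: nearW => n; rewrite normr_ge0 fg.
Qed.

Lemma normc_le (a : R[i]) : complex.Re `|a| <= `|complex.Re a| + `|complex.Im a|.
Proof.
case: a => a b; rewrite normc_def /=.
rewrite -[leRHS]ger0_norm ?addr_ge0 // -sqrtr_sqr ler_wsqrtr // sqrrD !real_normK ?num_real //.
by rewrite -subr_ge0 [X in 0 <= X](_ : _ = `|a| * `|b| *+ 2) ?mulrn_wge0 ?mulr_ge0 //; ring.
Qed.

Lemma weak_null_sum w (P : seq (H * H)) : weak_cvg w 0 ->
  (fun n => nrm (\sum_(p <- P) inner (w n) p.1 *: p.2)) @ U --> (0 : R).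
Proof.
move=> w0; have h0 y : (fun n => rdot (w n) y) @ U --> (0 : R).
  by have := w0 y; rewrite [rdot 0 y](_ : _ = 0) // /rdot inner0l.
elim: P => [|p P IH].
  by under eq_fun do rewrite big_nil nrm0; exact: cvg_cst.
apply: (@cvg_squeeze0 _ (fun n => (`|rdot (w n) p.1| + `|rdot (w n) ('i *: p.1)|) * nrm p.2 +
   nrm (\sum_(p <- P) inner (w n) p.1 *: p.2))).
  move=> n; rewrite big_cons ger0_norm ?nrm_ge0 // (le_trans (nrmD _ _)) // lerD2r.
  by rewrite nrmZ ler_wpM2r ?nrm_ge0 // (le_trans (normc_le _)) // inner_rdot.
rewrite -[0 : R]addr0; apply: cvgD => //.
rewrite -(mul0r (nrm p.2)); apply: cvgM; last exact: cvg_cst.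
rewrite -[0 : R]addr0; apply: cvgD; rewrite -(normr0 R); exact: cvg_norm.
Qed.

(** Up to a finite-rank part tending to zero in norm, [w n] lies in some [orth fs], where the form
    [D] is small. *)
Lemma ess_scalar_weak_null T (al d M : R) w : ess_scalar T al -> weak_cvg w 0 ->
  (forall n, nrm (w n) <= M) -> (fun n => nrm (w n) ^+ 2) @ U --> d ->
  (fun n => nrm (T (w n)) ^+ 2) @ U --> al ^+ 2 * d.
Proof.
move=> eT w0 wM wd; have [K K0 TK] := bounded_op_nrm T.
pose D x := nrm (T x) ^+ 2 - al ^+ 2 * nrm x ^+ 2.
suff D0 : (fun n => D (w n)) @ U --> (0 : R).
  have -> : (fun n => nrm (T (w n)) ^+ 2) = (fun n => D (w n) + al ^+ 2 * nrm (w n) ^+ 2).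
    by apply/funext => n; rewrite /D subrK.
  rewrite -[al ^+ 2 * d]add0r; apply: cvgD => //; apply: cvgM => //; exact: cvg_cst.
apply/cvgrPdist_lt => e e0.
have M0 : 0 <= M := le_trans (nrm_ge0 _) (wM 0%N).
pose e' := e / (M ^+ 2 + 1).
have M2 : 0 < M ^+ 2 + 1 by rewrite ltr_wpDl ?sqr_ge0.
have e0' : 0 < e' by rewrite divr_gt0.
have [fs hfs] := eT e' e0'; have [P hP] := orth_decomp fs.
pose p n := \sum_(p <- P) inner (w n) p.1 *: p.2.
pose pi n := nrm (p n).
have pi0 : pi @ U --> (0 : R) := weak_null_sum P w0.
(* The first term bounds [D] on [orth fs], the second the contributions of [p n]; at [t = 0] only
   [e' * M ^+ 2 < e] remains. *)
pose B (t : R) := e' * ((M + t) * (M + t)) + (K ^+ 2 + al ^+ 2) * (2 * ((M + t) * t) + t * t).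
have DB n : `|D (w n)| <= B (pi n).
  have := hP (w n); rewrite -/(p n) => /hfs; set q := w n - p n => hq.
  have qM : nrm q <= M + pi n.
    by rewrite (le_trans (nrmD _ _)) // nrmN lerD.
  have wE : w n = q + p n by rewrite subrK.
  have -> : D (w n) = (nrm (T q) ^+ 2 - al ^+ 2 * nrm q ^+ 2) +
      (2 * rdot (T q) (T (p n)) + nrm (T (p n)) ^+ 2 - al ^+ 2 * (2 * rdot q (p n) + pi n ^+ 2)).
    by rewrite /D wE linearD !nrm_sqrD /pi; ring.
  rewrite (le_trans (ler_normD _ _)) // /B lerD //.
    rewrite (le_trans hq) // ler_pM2l // -expr2 lerXn2r ?nnegrE ?nrm_ge0 //.
    by rewrite addr_ge0 // nrm_ge0.
  have Tq := TK q; have Tp := TK (p n).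
  have r1 := rdot_le q (p n); have r2 := rdot_le (T q) (T (p n)).
  have r3 : nrm (T q) * nrm (T (p n)) <= K ^+ 2 * ((M + pi n) * pi n).
    have -> : K ^+ 2 * ((M + pi n) * pi n) = (K * (M + pi n)) * (K * pi n) by ring.
    apply: ler_pM; rewrite ?nrm_ge0 //; rewrite (le_trans Tq) // ler_pM2l //.
  have r4 : nrm q * nrm (p n) <= (M + pi n) * pi n by rewrite ler_wpM2r ?nrm_ge0.
  have r5 : nrm (T (p n)) ^+ 2 <= K ^+ 2 * pi n ^+ 2.
    by rewrite -exprMn lerXn2r ?nnegrE ?mulr_ge0 ?nrm_ge0 // ltW.
  have r6 : al ^+ 2 * `|2 * rdot q (p n) + pi n ^+ 2| <=
      al ^+ 2 * (2 * ((M + pi n) * pi n) + pi n ^+ 2).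
    rewrite ler_wpM2l ?sqr_ge0 // (le_trans (ler_normD _ _)) // normrM ger0_norm //.
    by rewrite [`|pi n ^+ 2|]ger0_norm ?sqr_ge0 // lerD2r ler_pM2l // (le_trans r1).
  apply: (le_trans (ler_normB _ _)).
  rewrite normrM (ger0_norm (sqr_ge0 al)).
  have r7 : `|2 * rdot (T q) (T (p n)) + nrm (T (p n)) ^+ 2| <=
      2 * (K ^+ 2 * ((M + pi n) * pi n)) + K ^+ 2 * pi n ^+ 2.
    rewrite (le_trans (ler_normD _ _)) // normrM ger0_norm //.
    rewrite [`|nrm _ ^+ 2|]ger0_norm ?sqr_ge0 // lerD // ler_pM2l // (le_trans r2) //.
  apply: (le_trans (lerD r7 r6)); rewrite le_eqVlt; apply/orP; left; apply/eqP; ring.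
have Bc : (B \o pi) @ U --> B 0.
  have c0 : forall c : R, (fun _ : nat => c) @ U --> c by move=> c; exact: cvg_cst.
  have Mc : (fun n => M + pi n) @ U --> M + 0 by apply: cvgD.
  rewrite /B /comp; apply: cvgD; apply: cvgM => //; first exact: cvgM.
  by apply: cvgD; [apply: cvgM => //|]; apply: cvgM.
have B0 : B 0 < e.
  rewrite /B addr0 !mulr0 addr0 mulr0 addr0 -expr2 /e' mulrAC ltr_pdivrMr //.
  by rewrite ltr_pM2l // ltrDl.
near=> n; rewrite sub0r normrN (le_lt_trans (DB n)) //.
near: n; exact: (cvgr_lt _ Bc _ B0).
Unshelve. all: by end_near. Qed.

(** Pythagoras in the limit, as the cross term vanishes; [d] is the mass lost by weak
    convergence. *)
Lemma weak_cvg_nrm_sqr u z (d : R) : weak_cvg u z ->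
  (fun n => nrm (u n - z) ^+ 2) @ U --> d ->
  (fun n => nrm (u n) ^+ 2) @ U --> nrm z ^+ 2 + d.
Proof.
move=> uz ud.
have -> : (fun n => nrm (u n) ^+ 2) = (fun n => nrm z ^+ 2 +
   2 * (rdot (u n) z - rdot z z) + nrm (u n - z) ^+ 2).
  apply/funext => n; have := nrm_sqrD (u n - z) z; rewrite subrK => ->.
  by rewrite rdotBl; ring.
apply: cvgD => //; rewrite -[X in _ --> X]addr0; apply: cvgD; first exact: cvg_cst.
rewrite -[X in _ --> X](mulr0 2); apply: cvgM; first exact: cvg_cst.
by rewrite -(subrr (rdot z z)); apply: cvgB; [exact: uz|exact: cvg_cst].
Qed.

Lemma ess_scalar_weak_cvg T (al d M : R) u z : ess_scalar T al -> weak_cvg u z ->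
  (forall n, nrm (u n) <= M) -> (fun n => nrm (u n - z) ^+ 2) @ U --> d ->
  (fun n => nrm (T (u n) - T z) ^+ 2) @ U --> al ^+ 2 * d.
Proof.
move=> eT uz uM ud; under eq_fun do rewrite -linearB.
apply: (@ess_scalar_weak_null _ _ _ (M + nrm z)) => //; first exact: weak_cvgB.
by move=> n; rewrite (le_trans (nrmD _ _)) // nrmN lerD2r.
Qed.

(** Each application of [T] multiplies the lost mass by [al ^+ 2]. *)
Lemma ess_scalar_weak_cvg_iter T (al d M : R) u z j : ess_scalar T al ->
  weak_cvg u z -> (forall n, nrm (u n) <= M) ->
  (fun n => nrm (u n - z) ^+ 2) @ U --> d ->
  (fun n => nrm (iter j T (u n)) ^+ 2) @ U -->
    nrm (iter j T z) ^+ 2 + al ^+ (2 * j) * d.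
Proof.
move=> eT uz uM ud; have [K K0 TK] := bounded_op_nrm T.
suff [h1 h2 h3] : [/\ weak_cvg (fun n => iter j T (u n)) (iter j T z),
    (forall n, nrm (iter j T (u n)) <= K ^+ j * M) &
    (fun n => nrm (iter j T (u n) - iter j T z) ^+ 2) @ U --> al ^+ (2 * j) * d].
  exact: weak_cvg_nrm_sqr.
elim: j => [|j [h1 h2 h3]]; first by rewrite muln0 !mul1r; split.
split.
- exact: weak_cvg_op.
- by move=> n; rewrite /= (le_trans (TK _)) // exprS -mulrA ler_pM2l.
- by rewrite mulnS exprD -mulrA; exact: ess_scalar_weak_cvg h2 h3.
Qed.

Lemma weak_limit_unit u : (forall n, nrm (u n) = 1) -> exists z d,
  [/\ weak_cvg u z, (fun n => nrm (u n - z) ^+ 2) @ U --> d, 0 <= d &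
      nrm z ^+ 2 + d = 1].
Proof.
move=> u1; have [n|z uz] := @weak_limit u 1; first by rewrite u1.
have [n|d ud] := @ultra_bounded_cvg (fun n => nrm (u n - z) ^+ 2) ((1 + nrm z) ^+ 2).
  rewrite ger0_norm ?sqr_ge0 // lerXn2r ?nnegrE ?addr_ge0 ?nrm_ge0 //.
  by rewrite (le_trans (nrmD _ _)) // nrmN u1.
exists z, d; split=> //.
  by apply: (cvgr_to_ge ud); apply: nearW => n; exact: sqr_ge0.
apply: (cvg_unique (@Rhausdorff R) (weak_cvg_nrm_sqr uz ud)).
rewrite (_ : (fun n => _) = (fun _ => 1)); first exact: cvg_cst.
by apply/funext => n; rewrite u1 expr1n.
Qed.

End WeakLimits.

(** * Eigenvectors in invariant subspaces *)

Section Eigenvector.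
Context (R : realType) (H : hilbertType R).
Implicit Types (x y z : H) (fs : seq H) (T : 'B(H)) (p : {poly R[i]}).

Definition poly_act T p x := \sum_(i < size p) p`_i *: iter i T x.

Lemma poly_actE T p x n : (size p <= n)%N ->
  poly_act T p x = \sum_(i < n) p`_i *: iter i T x.
Proof.
move=> pn; rewrite /poly_act (big_ord_widen n (fun i => p`_i *: iter i T x)) //.
rewrite big_mkcond; apply: eq_bigr => i _.
by case: ltnP => // h; rewrite nth_default // scale0r.
Qed.

Lemma iter_linear T n a x y : iter n T (a *: x + y) = a *: iter n T x + iter n T y.
Proof. by elim: n => //= n ->; rewrite linearP. Qed.

Lemma poly_act_mulXsubC T p c x :
  poly_act T (p * ('X - c%:P)) x = poly_act T p (T x - c *: x).
Proof.
have sp : (size (p * ('X - c%:P))%R <= (size p).+1)%N.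
  by rewrite (leq_trans (size_polyMleq _ _)) // size_XsubC addn2.
rewrite (@poly_actE T _ _ _ sp) [RHS]/poly_act.
have iB i : iter i T (T x - c *: x) = iter i.+1 T x - c *: iter i T x.
  by rewrite addrC -scaleNr iter_linear scaleNr addrC -iterSr.
under [RHS]eq_bigr do rewrite iB scalerBr.
rewrite sumrB.
under eq_bigr do rewrite mulrBr coefB coefMX coefMC scalerBl.
rewrite sumrB big_ord_recl /= scale0r add0r; congr (_ - _).
rewrite big_ord_recr /= nth_default // mul0r scale0r addr0.
by apply: eq_bigr => i _; rewrite scalerA.
Qed.

(** Apply the factors [T - r] one by one: the first to annihilate the current nonzero vector
    exhibits an eigenvector. *)
Lemma poly_act_eigenvector T (V : set H) (rs : seq R[i]) z :
  (forall a x y, V x -> V y -> V (a *: x + y)) -> (forall x, V x -> V (T x)) ->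
  V z -> z != 0 -> poly_act T (\prod_(r <- rs) ('X - r%:P)) z = 0 ->
  exists v c, [/\ V v, v != 0 & T v = c *: v].
Proof.
move=> VD VT; elim: rs z => [|r rs IH] z Vz z0.
  rewrite big_nil /poly_act size_poly1 big_ord1 coef1 scale1r /= => z00.
  by rewrite z00 eqxx in z0.
rewrite big_cons mulrC poly_act_mulXsubC; have [h _|h] := eqVneq (T z - r *: z) 0.
  by exists z, r; split=> //; apply/eqP; rewrite -subr_eq0 h.
by apply: IH => //; rewrite addrC -scaleNr; apply: VD => //; exact: VT.
Qed.

(* On such a V the operator is rho times an isometry with rho <> alpha, so V
   meets a subspace of finite codimension trivially: V is finite-dimensional. *)
Lemma invariant_homothety_eigenvector T (al rho : R) (V : set H) z :
  ess_scalar T al -> rho ^+ 2 != al ^+ 2 ->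
  (forall a x y, V x -> V y -> V (a *: x + y)) -> (forall x, V x -> V (T x)) ->
  (forall x, V x -> nrm (T x) = rho * nrm x) -> V z -> z != 0 ->
  exists v c, [/\ V v, v != 0 & T v = c *: v].
Proof.
move=> eT ra VD VT Vr Vz z0; pose e := `|rho ^+ 2 - al ^+ 2| / 2.
have e1 : 0 < `|rho ^+ 2 - al ^+ 2| by rewrite normr_gt0 subr_eq0.
have e0 : 0 < e by rewrite divr_gt0.
have [fs hfs] := eT e e0.
have V0 x : V x -> orth fs x -> x = 0.
  move=> Vx /hfs; rewrite Vr // exprMn -mulrBl normrM (ger0_norm (sqr_ge0 (nrm x))).
  move=> h; apply/eqP; rewrite -nrm_eq0 -sqrf_eq0 -[_ == 0]negbK; apply/negP => x0.
  move: h; rewrite ler_pM2r; last by rewrite lt_neqAle eq_sym x0 sqr_ge0.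
  by rewrite /e leNgt => /negP; apply; rewrite ltr_pdivrMr // ltr_pMr // ltr1n.
pose n := size fs.
pose A : 'M[R[i]]_(n.+1, n) := \matrix_(i < n.+1, j < n) inner (iter i T z) fs`_j.
(* There are [n.+1] iterates of [z] and only [n] conditions, so a nontrivial combination of iterates
   is orthogonal to [fs], and zero by [V0]. *)
have /rowV0Pn[r /sub_kermxP rA r0] : kermx A != 0.
  by rewrite -mxrank_eq0 mxrank_ker subn_eq0 -ltnNge ltnS rank_leq_col.
pose p := \poly_(i < n.+1) r 0 (inord i).
have pE (i : 'I_n.+1) : p`_i = r 0 i by rewrite coef_poly ltn_ord inord_val.
have p0 : p != 0.
  apply: contraNneq r0 => p0; apply/eqP/rowP => i.
  by rewrite -pE p0 coef0 mxE.
have Vi i : V (iter i T z) by elim: i => //= i; exact: VT.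
have V00 : V 0 by have := VD (-1) z z Vz Vz; rewrite scaleN1r addNr.
have pz : poly_act T p z = 0.
  have sp : (size p <= n.+1)%N by exact: size_poly.
  rewrite (@poly_actE T _ _ _ sp); apply: V0.
    elim/big_ind: _ => // [x y Vx Vy|i _].
      by rewrite -[x]scale1r; exact: VD.
    by rewrite -[_ *: _]addr0; exact: VD.
  move=> f ffs; have fn : (index f fs < n)%N by rewrite index_mem.
  have := congr1 (fun B : 'rV[R[i]]_n => B 0 (Ordinal fn)) rA; rewrite !mxE => h; rewrite -[RHS]h.
  rewrite (big_morph (fun x => inner x f) (fun x y => innerDl x y f) (inner0l f)).
  apply: eq_bigr => i _.
  by rewrite innerZl pE mxE /= nth_index.
(* The relation splits into linear factors because [R[i]] is algebraically closed. *)
have [rs prs] := closed_field_poly_normal p.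
apply: (@poly_act_eigenvector T V rs z) => //.
have lp : lead_coef p != 0 by rewrite lead_coef_eq0.
apply: (scalerI lp); rewrite scaler0 -pz [in RHS]prs.
rewrite /poly_act size_scale // scaler_sumr.
by apply: eq_bigr => i _; rewrite coefZ scalerA.
Qed.

End Eigenvector.

(** * Growth of real sequences *)

Section Sequences.
Context (R : realType).
Implicit Types (p t : nat -> R).

Lemma exprn_bounded_le1 (s C : R) : 0 <= s -> (forall n, s ^+ n <= C) -> s <= 1.
Proof.
move=> s0 sC; rewrite leNgt; apply/negP => s1.
have bern n : 1 + n%:R * (s - 1) <= s ^+ n.
  elim: n => [|n IH]; first by rewrite mul0r addr0 expr0.
  have h : 1 <= s ^+ n by rewrite exprn_ege1 // ltW.
  rewrite exprS -natr1; move: (s ^+ n) IH h => x IH h; nra.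
have [n hn] : exists n : nat, C / (s - 1) < n%:R.
  exists (Num.bound (C / (s - 1))); apply: archi_boundP.
  by rewrite divr_ge0 ?subr_ge0 ?(ltW s1) // (le_trans _ (sC 0%N)).
have := le_trans (bern n) (sC n); apply/negP; rewrite -ltNge.
by rewrite ltr_pdivrMr ?subr_gt0 // in hn; rewrite (lt_trans hn) // ltrDr.
Qed.

Lemma geometric_le (g C a b : R) : 0 < g -> 0 <= a -> 0 < b ->
  (forall n, a ^+ n * g <= C * b ^+ n) -> a <= b.
Proof.
move=> g0 a0 b0 h; rewrite -[b]mul1r -ler_pdivrMr //.
apply: (@exprn_bounded_le1 _ (C / g)); first by rewrite divr_ge0 // ltW.
by move=> n; rewrite expr_div_n ler_pdivrMr ?exprn_gt0 // mulrAC ler_pdivlMr.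
Qed.

(* The ratios g_n of p satisfy g_(n+1) g_n^2 = c; this recursion expands away
   from its fixed point, so a bounded solution is constant. *)
Lemma bounded_ratio_const p (c K : R) : (forall n, 0 < p n) -> 0 < c ->
  (forall n, p n.+2 * p n.+1 = c * p n ^+ 2) -> (forall n, p n.+1 <= K * p n) ->
  p 1%N ^+ 3 = c * p 0%N ^+ 3.
Proof.
(* The cubed ratio, normalised to have fixed point 1; the recursion becomes
   [t n.+1 = (t n ^+ 2)^-1]. *)
move=> p0 c0 pc pK; pose t n := p n.+1 ^+ 3 / (c * p n ^+ 3).
have t0 n : 0 < t n by rewrite divr_gt0 ?mulr_gt0 ?exprn_gt0.
have tS n : t n.+1 = (t n ^+ 2)^-1.
  have e : p n.+2 = c * p n ^+ 2 / p n.+1 by rewrite -pc mulfK // gt_eqF.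
  rewrite /t e; have := p0 n; have := p0 n.+1; move: (p n) (p n.+1) => x y y0 x0.
  by field; rewrite !gt_eqF.
have tK n : t n <= K ^+ 3 / c.
  rewrite ler_pdivrMr ?mulr_gt0 ?exprn_gt0 // mulrA divfK ?gt_eqF // -exprMn.
  by rewrite lerXn2r ?nnegrE ?(ltW (p0 _)) // (le_trans (ltW (p0 n.+1))).
(* Two steps raise [t] to the fourth power, so a value above 1 would grow without bound. *)
have t1 n : t n <= 1.
  rewrite leNgt; apply/negP => tn1.
  suff : t n <= 1 by rewrite leNgt tn1.
  apply: (@exprn_bounded_le1 _ (K ^+ 3 / c)) => [|k]; first exact: ltW.
  apply: (le_trans _ (tK (n + 2 * k)%N)).
  apply: (@le_trans _ _ (t n ^+ k.+1)); first by rewrite exprS ler_peMl ?exprn_ge0 // ltW.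
  elim: k => [|k IH]; first by rewrite muln0 addn0.
  have -> : t (n + 2 * k.+1)%N = t (n + 2 * k)%N ^+ 4.
    by rewrite mulnS addnCA !tS -!exprVn invrK -!exprM.
  have tk : t n <= t (n + 2 * k)%N.
    by apply: (le_trans _ IH); rewrite exprS ler_peMr ?exprn_ege1 // ltW.
  have tk1 : 1 <= t (n + 2 * k)%N by rewrite (le_trans (ltW tn1)).
  rewrite exprS (@le_trans _ _ (t (n + 2 * k)%N ^+ 2)) //.
    by rewrite expr2 ler_pM // ?exprn_ge0 // ltW.
  by rewrite ler_weXn2l.
have h1 := t1 1%N; rewrite tS invf_le1 ?exprn_gt0 // in h1.
have : t 0%N = 1.
  apply/eqP; rewrite eq_le t1 /= leNgt; apply/negP => h.
  by move: h1; apply/negP; rewrite -ltNge expr_lt1 // ltW.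
by move/divr1_eq.
Qed.
End Sequences.

(** * Star-paranormal operators off their eigenvectors: the upper bound *)

Section StarParanormal.
Context (R : realType) (H : hilbertType R) (T : 'B(H)).
Context (spT : star_paranormal T).
Implicit Types (x y z v : H) (c : R[i]).

Lemma star_paranormal_nrm x : nrm (adjoint T x) ^+ 2 <= nrm (T (T x)) * nrm x.
Proof. by have := spT x; rewrite !nrmE -rmorphXn -rmorphM lecR. Qed.

(** Cauchy-Schwarz bounds [nrm (T y) ^+ 2] by [nrm (adjoint T (T y)) * nrm y]; star-paranormality at
    [T y] bounds the adjoint, and one factor [nrm (T y)] cancels. *)
Lemma star_paranormal_cube y : nrm (T y) ^+ 3 <= nrm (T (T (T y))) * nrm y ^+ 2.
Proof.
have [->|Ty0] := eqVneq (nrm (T y)) 0.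
  by rewrite expr0n mulr_ge0 ?exprn_ge0 ?nrm_ge0.
have t0 : 0 < nrm (T y) by rewrite lt_neqAle eq_sym Ty0 nrm_ge0.
have h1 : nrm (T y) ^+ 2 <= nrm (adjoint T (T y)) * nrm y.
  by rewrite -rdotxx rdot_adjoint rdotC (le_trans (ler_norm _)) // rdot_le.
rewrite -(ler_pM2r t0) -exprSr.
have -> : nrm (T y) ^+ 4 = (nrm (T y) ^+ 2) ^+ 2 by rewrite -exprM.
apply: (@le_trans _ _ ((nrm (adjoint T (T y)) * nrm y) ^+ 2)).
  by rewrite lerXn2r ?nnegrE ?mulr_ge0 ?exprn_ge0 ?nrm_ge0.
rewrite exprMn [leRHS]mulrAC ler_wpM2r ?exprn_ge0 ?nrm_ge0 //.
exact: star_paranormal_nrm.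
Qed.

(** Expand the squared norm of the difference: star-paranormality bounds the first square by exactly
    what the cross term removes. *)
Lemma adjoint_eigenvector v c : T v = c *: v -> adjoint T v = c^*%R *: v.
Proof.
move=> Tv; apply/eqP; rewrite -subr_eq0 -nrm_eq0 -sqrf_eq0 eq_le sqr_ge0 andbT.
pose k := complex.Re `|c|.
have kc : `|c| = k%:C by rewrite RRe_real // ger0_real.
have h1 : nrm (adjoint T v) ^+ 2 <= (k * nrm v) ^+ 2.
  rewrite (le_trans (star_paranormal_nrm v)) // Tv linearZ /= Tv !nrmZ -/k.
  by rewrite le_eqVlt; apply/orP; left; apply/eqP; ring.
have h2 : nrm (c^*%R *: v) ^+ 2 = (k * nrm v) ^+ 2.
  by rewrite nrmZ norm_conjC -/k.
have h3 : rdot (adjoint T v) (c^*%R *: v) = (k * nrm v) ^+ 2.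
  rewrite /rdot innerZr conjCK -adjointEr Tv innerZr mulrA -normCK innerxx nrmE kc.
  by rewrite -!rmorphXn -rmorphM exprMn.
by rewrite nrm_sqrB h2 h3; lra.
Qed.

Definition eigen_orth : set H := [set x | forall v c, T v = c *: v -> inner x v = 0].

Lemma eigen_orthP a x y : eigen_orth x -> eigen_orth y -> eigen_orth (a *: x + y).
Proof.
move=> hx hy v c Tv.
by rewrite innerDl innerZl (hx _ _ Tv) (hy _ _ Tv) mulr0 addr0.
Qed.

Lemma eigen_orth0 : eigen_orth 0.
Proof. by move=> v c _; rewrite inner0l. Qed.

Lemma eigen_orthZ a x : eigen_orth x -> eigen_orth (a *: x).
Proof. by move=> hx; rewrite -[a *: x]addr0; apply: eigen_orthP eigen_orth0. Qed.

Lemma eigen_orth_op x : eigen_orth x -> eigen_orth (T x).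
Proof.
move=> hx v c Tv; rewrite adjointE (adjoint_eigenvector Tv) innerZr.
by rewrite (hx _ _ Tv) mulr0.
Qed.

Lemma eigen_orth_adjoint x : eigen_orth x -> eigen_orth (adjoint T x).
Proof. by move=> hx v c Tv; rewrite -adjointEr Tv innerZr (hx _ _ Tv) mulr0. Qed.

Lemma eigen_orth_iter n x : eigen_orth x -> eigen_orth (iter n T x).
Proof. by move=> hx; elim: n => //= n; exact: eigen_orth_op. Qed.

(** For [c] nonzero, [c * inner (S x) v] equals [inner (T (S x)) v] by the eigenvector relation for
    the adjoint; for [c = 0], injectivity makes [v] zero. *)
Lemma eigen_orth_inv (S : 'B(H)) x : cancel T S -> cancel S T ->
  eigen_orth x -> eigen_orth (S x).
Proof.
move=> TS ST hx v c Tv; have [c0|c0] := eqVneq c 0.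
  by rewrite -(TS v) Tv c0 scale0r linear0 inner0r.
apply: (mulfI c0); rewrite mulr0 -[c]conjCK -innerZr -(adjoint_eigenvector Tv).
by rewrite -adjointE ST (hx _ _ Tv).
Qed.

Lemma eigen_orth_no_eigenvector v c : eigen_orth v -> T v = c *: v -> v = 0.
Proof.
move=> hv Tv; apply/eqP; rewrite -nrm_eq0 -sqrf_eq0 -rdotxx /rdot (hv _ _ Tv) //.
Qed.

Lemma eigen_orth_weak (U : set_system nat) (u : nat -> H) z : UltraFilter U ->
  (forall n, eigen_orth (u n)) -> weak_cvg U u z -> eigen_orth z.
Proof.
move=> UU hu uz v c Tv; have FU : ProperFilter U := @ultra_proper _ _ UU.
have r0 (a : R[i]) : rdot z (a *: v) = 0.
  apply: (cvg_unique (@Rhausdorff R) (uz (a *: v))).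
  rewrite (_ : (fun n => _) = (fun _ => 0)); first exact: cvg_cst.
  by apply/funext => n; rewrite /rdot innerZr (hu n _ _ Tv) mulr0.
by rewrite inner_rdot r0 -[v in rdot z v]scale1r r0.
Qed.

Lemma eigen_orth_op_le (al : R) y : 0 <= al -> ess_scalar T al ->
  eigen_orth y -> nrm (T y) <= al * nrm y.
Proof.
move=> al0 eT Wy; rewrite leNgt; apply/negP => Ty.
have y0 : 0 < nrm y.
  rewrite nrm_gt0; apply/eqP => y0; move: Ty.
  by rewrite y0 linear0 nrm0 mulr0 ltxx.
pose A := [set nrm (T x) | x in [set x | eigen_orth x /\ nrm x = 1]].
have unit x : eigen_orth x -> 0 < nrm x -> A (nrm (T x) / nrm x).
  move=> Wx x0; exists ((nrm x)^-1%:C *: x); first split.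
  - exact: eigen_orthZ.
  - by rewrite nrmZr ger0_norm ?invr_ge0 ?nrm_ge0 // mulVf // gt_eqF.
  - by rewrite linearZ nrmZr mulrC ger0_norm // invr_ge0 nrm_ge0.
have supA : has_sup A.
  have [K K0 TK] := bounded_op_nrm T.
  split; first by eexists; exact: unit Wy y0.
  by exists K => _ [x [_ x1] <-]; rewrite (le_trans (TK x)) // x1 mulr1.
pose s := sup A.
have Ws x : eigen_orth x -> nrm (T x) <= s * nrm x.
  move=> Wx; have [->|x0] := eqVneq x 0; first by rewrite linear0 !nrm0 mulr0.
  rewrite -ler_pdivrMr ?nrm_gt0 //; apply: ub_le_sup; first exact: supA.2.
  by apply: unit; rewrite ?nrm_gt0.
have als : al < s.
  by rewrite -(ltr_pM2r y0) (lt_le_trans Ty) // Ws.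
have s0 : 0 < s by rewrite (le_lt_trans al0).
have /choice[u uP] : forall n : nat, exists x,
    [/\ eigen_orth x, nrm x = 1 & s - n.+1%:R^-1 < nrm (T x)].
  move=> n; have n0 : 0 < n.+1%:R^-1 :> R by rewrite invr_gt0.
  by have [_ [x [Wx x1] <-] h] := sup_adherent n0 supA; exists x.
have [U [UU subU]] := ultraFilterLemma eventually_filter.
have FU : ProperFilter U := @ultra_proper _ _ UU.
have u1 n : nrm (u n) = 1 by case: (uP n).
have [z [d [uz ud d0 zd]]] := weak_limit_unit UU u1.
have Wz : eigen_orth z by apply: eigen_orth_weak uz => // n; case: (uP n).
have Tus : (fun n => nrm (T (u n))) @ U --> s.
  apply: (@cvg_trans _ ((fun n => nrm (T (u n))) @ \oo)); first exact: cvg_app.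
  apply: (@squeeze_cvgr _ _ _ _ (fun n : nat => s - n.+1%:R^-1) (fun _ => s)).
  - apply: nearW => n; have [Wu _ /ltW ->] := uP n.
    by rewrite (le_trans (Ws _ Wu)) // u1 mulr1.
  - rewrite -[X in _ --> X]subr0; apply: cvgB; [exact: cvg_cst|exact: cvg_harmonic].
  - exact: cvg_cst.
have Tz2 : nrm (T z) ^+ 2 + al ^+ 2 * d = s ^+ 2.
  apply: (cvg_unique (@Rhausdorff R)
    (@ess_scalar_weak_cvg_iter _ _ _ UU T al d 1 u z 1%N eT uz _ ud)).
    by move=> n; rewrite u1.
  by rewrite !expr2; exact: cvgM.
have Tz : nrm (T z) ^+ 2 <= s ^+ 2 * nrm z ^+ 2.
  by rewrite -exprMn lerXn2r ?nnegrE ?mulr_ge0 ?nrm_ge0 ?(ltW s0) ?Ws.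
have al2 : al ^+ 2 < s ^+ 2 by rewrite ltr_pXn2r ?nnegrE // ltW.
(* Lost mass is stretched only by [al], less than [s], so a maximising sequence loses none. *)
have dE : d = 0 by apply/eqP; rewrite eq_le d0 andbT; nra.
have z1 : nrm z = 1.
  apply/eqP; rewrite -[_ == _](@eqrXn2 _ 2 _ 1) ?nrm_ge0 // expr1n -zd dE.
  by rewrite addr0.
have Tzs : nrm (T z) = s * nrm z.
  apply/eqP; rewrite -[_ == _](@eqrXn2 _ 2) ?mulr_ge0 ?nrm_ge0 ?(ltW s0) //.
  by rewrite z1 mulr1 -Tz2 dE mulr0 addr0.
have WD (r : R) x x' : eigen_orth x -> eigen_orth x' -> eigen_orth (x + r%:C *: x').
  by move=> Wx Wx'; rewrite addrC; exact: eigen_orthP.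
(* Norm attainment is encoded by the critical equation, which is linear in [x]. *)
pose V : set H := [set x | eigen_orth x /\
  forall x', eigen_orth x' -> rdot (T x) (T x') = s ^+ 2 * rdot x x'].
have VP x : eigen_orth x -> nrm (T x) = s * nrm x -> V x.
  by move=> Wx Tx; split=> // x'; exact: (norm_attained_critical WD Ws).
have Vs x : V x -> nrm (T x) = s * nrm x.
  move=> [Wx Vx]; apply/eqP; rewrite -[_ == _](@eqrXn2 _ 2) ?mulr_ge0 ?nrm_ge0 ?(ltW s0) //.
  by rewrite exprMn -!rdotxx Vx.
have rdotZ a x x' : rdot (a *: x) x' = rdot x (a^*%R *: x').
  by rewrite /rdot innerZl innerZr conjCK.
have VD a x x' : V x -> V x' -> V (a *: x + x').
  move=> [Wx Vx] [Wx' Vx']; split; first exact: eigen_orthP.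
  move=> w Ww; rewrite linearP !rdotDl !rdotZ -linearZ Vx ?Vx' ?mulrDr //.
  exact: eigen_orthZ.
have VT x : V x -> V (T x).
  move=> Vx; have [Wx _] := Vx; have Tx := Vs _ Vx.
  have [->|x0] := eqVneq x 0.
    rewrite linear0; apply: VP; first exact: eigen_orth0.
    by rewrite linear0 nrm0 mulr0.
  have x0' : 0 < nrm x by rewrite nrm_gt0.
  apply: VP; first exact: eigen_orth_op.
  apply/eqP; rewrite eq_le Ws ?andTb; last exact: eigen_orth_op.
  (* Together with [nrm (T (T (T x))) <= s * nrm (T (T x))] this gives
     [nrm (T (T x)) >= s * nrm (T x)]. *)
  have := star_paranormal_cube x; rewrite Tx.
  have := Ws _ (eigen_orth_op (eigen_orth_op Wx)).
  move: (nrm x) (nrm (T (T x))) (nrm (T (T (T x)))) x0' => a b e a0 eb h.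
  have h2 : (s * a) ^+ 3 <= s * b * a ^+ 2.
    by rewrite (le_trans h) // ler_wpM2r // sqr_ge0.
  rewrite -(ler_pM2r (mulr_gt0 s0 (exprn_gt0 2 a0))).
  by rewrite [leRHS](_ : _ = s * b * a ^+ 2) ?[leLHS](_ : _ = (s * a) ^+ 3) //; ring.
have [|||v [c [[Wv _] v0 Tv]]] := @invariant_homothety_eigenvector R H T al s V z eT _ VD VT Vs.
- by rewrite gt_eqF.
- exact: VP.
- by rewrite -nrm_eq0 z1 oner_eq0.
by move: v0; rewrite (eigen_orth_no_eigenvector Wv Tv) eqxx.
Qed.

End StarParanormal.

(** * The lower bound in the invertible case, and normality *)

Section InvertibleStarParanormal.
Context (R : realType) (H : hilbertType R) (T S : 'B(H)).
Context (spT : star_paranormal T) (TS : cancel T S) (ST : cancel S T).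
Implicit Types (x y z v : H) (c : R[i]).

(** With successive growth factors [g0], [g1] of the orbit this is [g1 * g0 ^+ 2], which is
    [rho ^+ 3] for constant growth [rho]. *)
Definition orbit_ratio y := nrm (T (T y)) * nrm (T y) / nrm y ^+ 2.

Let T_gt0 y : 0 < nrm y -> 0 < nrm (T y).
Proof.
rewrite !nrm_gt0; apply: contra => /eqP Ty0.
by rewrite -(TS y) Ty0 linear0.
Qed.

Let iter_gt0 n y : 0 < nrm y -> 0 < nrm (iter n T y).
Proof. by move=> y0; elim: n => //= n; exact: T_gt0. Qed.

Lemma orbit_ratioE y : 0 < nrm y ->
  nrm (T (T y)) * nrm (T y) = orbit_ratio y * nrm y ^+ 2.
Proof. by move=> y0; rewrite divfK // gt_eqF // exprn_gt0. Qed.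

(** The cubic inequality, multiplied by [nrm (T (T y))]. *)
Lemma orbit_ratio_op y : 0 < nrm y -> orbit_ratio y <= orbit_ratio (T y).
Proof.
move=> y0; have y1 := T_gt0 y0; have y2 := T_gt0 y1.
rewrite /orbit_ratio ler_pdivrMr ?exprn_gt0 // [leRHS]mulrAC ler_pdivlMr ?exprn_gt0 //.
have := star_paranormal_cube spT y.
move: (nrm (T (T (T y)))) (nrm (T (T y))) (nrm (T y)) (nrm y) y2 => a b c d b0 h.
rewrite [leLHS](_ : _ = b * c ^+ 3); last by ring.
by rewrite [leRHS](_ : _ = b * (a * d ^+ 2)) ?ler_pM2l //; ring.
Qed.

Lemma orbit_ratio_iter m n y : 0 < nrm y -> (m <= n)%N ->
  orbit_ratio (iter m T y) <= orbit_ratio (iter n T y).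
Proof.
move=> y0 /subnK <-; elim: (n - m)%N => // k IH.
by rewrite (le_trans IH) // addSn orbit_ratio_op // iter_gt0.
Qed.

Lemma orbit_ratioZ (r : R) y : 0 < r -> orbit_ratio (r%:C *: y) = orbit_ratio y.
Proof.
move=> r0; rewrite /orbit_ratio !linearZ !nrmZr gtr0_norm //.
have [->|y0] := eqVneq y 0; first by rewrite !linear0 !nrm0 !(mulr0, mul0r).
by field; rewrite !gt_eqF // nrm_gt0.
Qed.

(* The minimising sequence cannot lose mass [d] to weak convergence. *)
Lemma orbit_ratio_no_mass_loss (F : realFieldType) (a f d z0 z1 z2 : F) :
  0 < f -> f < a ^+ 3 -> 0 <= d -> 0 <= z0 -> 0 <= z1 -> 0 <= z2 ->
  f ^+ 2 * z0 ^+ 2 <= z2 * z1 ->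
  (z2 + a ^+ 4 * d) * (z1 + a ^+ 2 * d) = f ^+ 2 * (z0 + d) ^+ 2 -> d = 0.
Proof.
move=> f0 fa d0 z00 z10 z20 hz hE; apply/eqP; rewrite eq_le d0 andbT leNgt.
apply/negP => dp.
have a30 : 0 < a ^+ 3 by rewrite (lt_trans f0).
(* The arithmetic-geometric mean inequality, then the lower bound on [z2 * z1]. *)
have am : 2 * (a ^+ 3 * (f * z0)) <= a ^+ 2 * z2 + a ^+ 4 * z1.
  have n1 : 0 <= a ^+ 2 * z2 + a ^+ 4 * z1.
    by apply: addr_ge0; apply: mulr_ge0 => //; exact: exprn_even_ge0.
  have n2 : 0 <= 2 * (a ^+ 3 * (f * z0)).
    apply: mulr_ge0 => //; apply: mulr_ge0; first exact: ltW.
    by apply: mulr_ge0 => //; exact: ltW.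
  rewrite -(ler_pXn2r (n := 2)) ?nnegrE //.
  have h1 : 0 <= (a ^+ 2 * z2 - a ^+ 4 * z1) ^+ 2 by rewrite sqr_ge0.
  have h2 : 0 <= (a ^+ 3) ^+ 2 * (z2 * z1 - f ^+ 2 * z0 ^+ 2).
    by rewrite mulr_ge0 ?sqr_ge0 // subr_ge0.
  rewrite -subr_ge0.
  rewrite [X in 0 <= X](_ : _ = (a ^+ 2 * z2 - a ^+ 4 * z1) ^+ 2 +
    4 * ((a ^+ 3) ^+ 2 * (z2 * z1 - f ^+ 2 * z0 ^+ 2))); last by ring.
  by rewrite addr_ge0 // mulr_ge0.
have h3 : 0 <= d * (a ^+ 2 * z2 + a ^+ 4 * z1 - 2 * (a ^+ 3 * (f * z0))).
  by rewrite mulr_ge0 // subr_ge0.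
have h4 : 0 <= 2 * d * f * z0 * (a ^+ 3 - f).
  apply: mulr_ge0; last by rewrite subr_ge0 ltW.
  by apply: mulr_ge0 => //; apply: mulr_ge0; [exact: mulr_ge0|exact: ltW].
have h5 : 0 < d ^+ 2 * ((a ^+ 3 - f) * (a ^+ 3 + f)).
  by rewrite mulr_gt0 ?exprn_gt0 // mulr_gt0 ?subr_gt0 ?addr_gt0.
have : 0 < (z2 + a ^+ 4 * d) * (z1 + a ^+ 2 * d) - f ^+ 2 * (z0 + d) ^+ 2.
  rewrite [X in 0 < X](_ : _ = (z2 * z1 - f ^+ 2 * z0 ^+ 2) +
    d * (a ^+ 2 * z2 + a ^+ 4 * z1 - 2 * (a ^+ 3 * (f * z0))) +
    2 * d * f * z0 * (a ^+ 3 - f) + d ^+ 2 * ((a ^+ 3 - f) * (a ^+ 3 + f))); last by ring.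
  rewrite ltr_wpDl // addr_ge0 // addr_ge0 // subr_ge0 //.
by rewrite hE subrr ltxx.
Qed.

Lemma eigen_orth_op_ge (al : R) y : 0 <= al -> ess_scalar T al ->
  eigen_orth T y -> al * nrm y <= nrm (T y).
Proof.
move=> al0 eT Wy; rewrite leNgt; apply/negP => Ty.
have y0 : 0 < nrm y.
  rewrite nrm_gt0; apply/eqP => y0; move: Ty.
  by rewrite y0 linear0 nrm0 mulr0 ltxx.
have alp : 0 < al by rewrite -(pmulr_lgt0 _ y0) (le_lt_trans (nrm_ge0 (T y))).
have [K K0 TK] := bounded_op_nrm T; have [L L0 SL] := bounded_op_nrm S.
have Tge x : nrm x <= L * nrm (T x) by rewrite -{1}(TS x).
pose A := [set orbit_ratio x | x in [set x | eigen_orth T x /\ 0 < nrm x]].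
(* Boundedness of the inverse keeps the infimum [f] positive. *)
have Alb x : 0 < nrm x -> (L ^+ 3)^-1 <= orbit_ratio x.
  move=> x0; rewrite ler_pdivlMr ?exprn_gt0 // mulrC ler_pdivrMr ?exprn_gt0 //.
  have := Tge x; have := Tge (T x); have := T_gt0 x0; have := T_gt0 (T_gt0 x0).
  move: (nrm x) (nrm (T x)) (nrm (T (T x))) x0 => a b e a0 e0 b0 h1 h2.
  have h3 : a ^+ 2 <= (L * b) ^+ 2 by rewrite lerXn2r ?nnegrE ?mulr_ge0 // ltW.
  rewrite (le_trans h3) // [leRHS](_ : _ = L ^+ 2 * b * (L * e)); last by ring.
  rewrite [leLHS](_ : _ = L ^+ 2 * b * b); last by ring.
  by rewrite ler_wpM2l // mulr_ge0 ?sqr_ge0 // ltW.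
have infA : has_inf A.
  split; first by exists (orbit_ratio y), y.
  by exists (L ^+ 3)^-1 => _ [x [_ x0] <-]; exact: Alb.
pose f := inf A.
have f0 : 0 < f.
  apply: (@lt_le_trans _ _ (L ^+ 3)^-1); first by rewrite invr_gt0 exprn_gt0.
  apply: lb_le_inf; first exact: infA.1.
  by move=> _ [x [_ x0] <-]; exact: Alb.
have fA x : eigen_orth T x -> 0 < nrm x -> f <= orbit_ratio x.
  by move=> Wx x0; apply: ge_inf; [exact: infA.2|exists x].
(* The ratio of the offending [y] is already below [al ^+ 3], by the upper bound at [T y]. *)
have fal : f < al ^+ 3.
  apply: (le_lt_trans (fA _ Wy y0)); rewrite ltr_pdivrMr ?exprn_gt0 //.
  have := eigen_orth_op_le spT al0 eT (eigen_orth_op spT Wy).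
  have := T_gt0 y0; move: (nrm y) (nrm (T y)) (nrm (T (T y))) y0 Ty => a b e a0 ba b0 eb.
  apply: (@le_lt_trans _ _ (al * b * b)); first by rewrite ler_pM2r.
  rewrite [ltRHS](_ : _ = al * ((al * a) * (al * a))); last by ring.
  by rewrite -mulrA ltr_pM2l // ltr_pM // ltW.
have /choice[v vP] : forall n : nat, exists x,
    [/\ eigen_orth T x, 0 < nrm x & orbit_ratio x < f + n.+1%:R^-1].
  move=> n; have n0 : 0 < n.+1%:R^-1 :> R by rewrite invr_gt0.
  by have [_ [x [Wx x1] <-] h] := inf_adherent n0 infA; exists x.
have S_gt0 x : 0 < nrm x -> 0 < nrm (S x).
  by rewrite !nrm_gt0; apply: contra => /eqP Sx0; rewrite -(ST x) Sx0 linear0.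
have Sn_gt0 n x : 0 < nrm x -> 0 < nrm (iter n S x).
  by move=> x0; elim: n => //= n; exact: S_gt0.
have WS n x : eigen_orth T x -> eigen_orth T (iter n S x).
  by move=> Wx; elim: n => //= n; exact: (eigen_orth_inv spT TS ST).
have TSn n x : iter n T (iter n S x) = x.
  by elim: n x => //= n IH x; rewrite -iterS iterSr /= ST IH.
(* Moving the minimising sequence far back along its orbits makes the ratio
   nearly minimal along the whole forward orbit of [u n]. *)
pose u n := (nrm (iter n S (v n)))^-1%:C *: iter n S (v n).
have vn0 n : 0 < nrm (iter n S (v n)) by apply: Sn_gt0; case: (vP n).
have u1 n : nrm (u n) = 1.
  by rewrite nrmZr ger0_norm ?invr_ge0 ?nrm_ge0 // mulVf // gt_eqF.
have u0 n : 0 < nrm (u n) by rewrite u1.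
have Wu n : eigen_orth T (u n).
  by apply: eigen_orthZ; apply: WS; case: (vP n).
have iterZ j a x : iter j T (a *: x) = a *: iter j T x.
  by elim: j => //= j ->; rewrite linearZ.
have uf j n : (j <= n)%N -> orbit_ratio (iter j T (u n)) <= f + n.+1%:R^-1.
  move=> jn; have [_ _ /ltW] := vP n; apply: le_trans.
  rewrite (le_trans (orbit_ratio_iter (u0 n) jn)) // iterZ TSn.
  by rewrite orbit_ratioZ // invr_gt0.
have [U [UU subU]] := ultraFilterLemma eventually_filter.
have FU : ProperFilter U := @ultra_proper _ _ UU.
have [z [d [uz ud d0 zd]]] := weak_limit_unit UU u1.
have Wz : eigen_orth T z by apply: eigen_orth_weak uz.
have lim j : (fun n => nrm (iter j T (u n)) ^+ 2) @ U -->
    nrm (iter j T z) ^+ 2 + al ^+ (2 * j) * d.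
  apply: (@ess_scalar_weak_cvg_iter _ _ _ UU T al d 1 u z j eT uz _ ud) => n.
  by rewrite u1.
have ratio_lim j : (fun n => orbit_ratio (iter j T (u n))) @ U --> f.
  apply: (@cvg_trans _ ((fun n => orbit_ratio (iter j T (u n))) @ \oo)).
    exact: cvg_app.
  apply: (@squeeze_cvgr _ _ _ _ (fun _ : nat => f) (fun n => f + n.+1%:R^-1)).
  - near=> n; rewrite fA ?iter_gt0 //; last exact: eigen_orth_iter.
    by rewrite uf //; near: n; exact: nbhs_infty_ge.
  - exact: cvg_cst.
  - rewrite -[X in _ --> X]addr0; apply: cvgD; [exact: cvg_cst|exact: cvg_harmonic].
(* The limit of the squared defining relation of the ratio along the orbits of [u n]. *)
have rec j : (nrm (iter j.+2 T z) ^+ 2 + al ^+ (2 * j.+2) * d) *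
    (nrm (iter j.+1 T z) ^+ 2 + al ^+ (2 * j.+1) * d) =
    f ^+ 2 * (nrm (iter j T z) ^+ 2 + al ^+ (2 * j) * d) ^+ 2.
  apply: (cvg_unique (@Rhausdorff R) (cvgM (lim j.+2) (lim j.+1))).
  rewrite (_ : (fun n => _) \* _ = (fun n =>
     orbit_ratio (iter j T (u n)) * orbit_ratio (iter j T (u n)) *
     (nrm (iter j T (u n)) ^+ 2 * nrm (iter j T (u n)) ^+ 2))).
    by rewrite !(expr2 (_ + _)) (expr2 f); apply: cvgM; apply: cvgM.
  apply/funext => n; rewrite /= -exprMn orbit_ratioE ?iter_gt0 //; ring.
have dE : d = 0.
  have := rec 0%N; rewrite !mul1r; apply: orbit_ratio_no_mass_loss => //; rewrite ?sqr_ge0 //.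
  have [->|z0] := eqVneq z 0; first by rewrite /= !linear0 nrm0 !expr0n !mulr0.
  have z0' : 0 < nrm z by rewrite nrm_gt0.
  rewrite -!exprMn lerXn2r ?nnegrE ?mulr_ge0 ?sqr_ge0 ?nrm_ge0 ?(ltW f0) //.
  by rewrite orbit_ratioE // ler_pM2r ?exprn_gt0 // fA.
have z1 : nrm z = 1.
  apply/eqP; rewrite -[_ == _](@eqrXn2 _ 2 _ 1) ?nrm_ge0 // expr1n -zd dE.
  by rewrite addr0.
have z0 : 0 < nrm z by rewrite z1.
have cube_ratio x : 0 < nrm x -> (forall n, orbit_ratio (iter n T x) = f) ->
    nrm (T x) ^+ 3 = f * nrm x ^+ 3.
  move=> x0 hx; apply: (@bounded_ratio_const _ (fun n => nrm (iter n T x)) f K) => //.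
  - by move=> n; exact: iter_gt0.
  - by move=> n; rewrite /= orbit_ratioE ?iter_gt0 // hx.
  - by move=> n; exact: TK.
have ratio_z n : orbit_ratio (iter n T z) = f.
  apply/eqP; rewrite -[_ == _](@eqrXn2 _ 2) ?(ltW f0) //; last first.
    by rewrite divr_ge0 ?mulr_ge0 ?sqr_ge0 ?nrm_ge0.
  have := rec n; rewrite dE !mulr0 !addr0 -exprMn /= orbit_ratioE ?iter_gt0 // exprMn.
  move/(mulIf _) => -> //.
  by rewrite gt_eqF // !exprn_gt0 // iter_gt0.
pose rho := nrm (T z).
have rho0 : 0 < rho by exact: T_gt0.
have rho3 : rho ^+ 3 = f by have := cube_ratio z z0 ratio_z; rewrite z1 expr1n mulr1.
have step_rho x : 0 < nrm x -> (forall n, orbit_ratio (iter n T x) = f) ->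
    nrm (T x) = rho * nrm x.
  move=> x0 hx; apply/eqP; rewrite -[_ == _](@eqrXn2 _ 3) ?mulr_ge0 ?nrm_ge0 ?(ltW rho0) //.
  by rewrite exprMn rho3 (cube_ratio x x0 hx).
(* A growth bound is stable under sums; equality of norms would not visibly be. *)
pose V : set H := [set x | eigen_orth T x /\
  exists C, forall n, nrm (iter n T x) <= C * rho ^+ n].
have VD a x x' : V x -> V x' -> V (a *: x + x').
  move=> [Wx [C hC]] [Wx' [C' hC']]; split; first exact: eigen_orthP.
  exists (complex.Re `|a| * C + C') => n; rewrite iter_linear (le_trans (nrmD _ _)) //.
  rewrite nrmZ mulrDl lerD // -mulrA ler_wpM2l //.
  by rewrite -ler0c RRe_real // ger0_real.
have VT x : V x -> V (T x).
  move=> [Wx [C hC]]; split; first exact: eigen_orth_op.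
  by exists (C * rho) => n; rewrite -iterSr -mulrA -exprS.
have Vz : V z.
  split=> //; exists 1 => n; rewrite mul1r; elim: n => [|n IH]; first by rewrite z1.
  rewrite /= step_rho ?iter_gt0 //; last by move=> m; rewrite -iterD ratio_z.
  by rewrite exprS ler_pM2l.
have Vratio x : V x -> 0 < nrm x -> orbit_ratio x = f.
  move=> [Wx [C hC]] x0; apply/eqP; rewrite eq_le fA // andbT.
  pose s n := nrm (iter n T x).
  have s0 n : 0 < s n by exact: iter_gt0.
  have C0 : 0 <= C by have := le_trans (nrm_ge0 _) (hC 0%N); rewrite mulr1.
  (* The quotient of [G n.+1] by [G n] is the ratio at the [n]-th iterate, at least that at [x]. As
     [G n] is at most [C ^+ 3 * rho * f ^+ n], the ratio at [x] is at most [f]. *)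
  pose G n := s n.+1 * s n ^+ 2.
  have G0 : 0 < G 0%N by rewrite mulr_gt0 // exprn_gt0.
  apply: (@geometric_le _ (G 0%N) (C ^+ 3 * rho)) => //.
    by rewrite divr_ge0 ?mulr_ge0 ?sqr_ge0 ?nrm_ge0.
  move=> n; apply: (@le_trans _ _ (G n)).
    elim: n => [|n IH]; first by rewrite mul1r.
    rewrite exprS -mulrA.
    have r0 : 0 <= orbit_ratio x by rewrite divr_ge0 ?mulr_ge0 ?sqr_ge0 ?nrm_ge0.
    apply: (le_trans (ler_wpM2l r0 IH)).
    have -> : G n.+1 = orbit_ratio (iter n T x) * G n.
      rewrite /G /s [RHS]mulrCA -orbit_ratioE ?iter_gt0 //=; ring.
    rewrite ler_pM2r ?mulr_gt0 ?exprn_gt0 //.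
    exact: (@orbit_ratio_iter 0 n).
  rewrite /G -rho3 [leRHS](_ : _ = (C * rho ^+ n.+1) * (C * rho ^+ n) ^+ 2); last first.
    by rewrite -exprM mulnC exprM (exprS rho n); ring.
  apply: ler_pM; rewrite ?sqr_ge0 ?(ltW (s0 _)) //; first exact: hC.
  rewrite lerXn2r ?nnegrE ?(ltW (s0 _)) ?mulr_ge0 ?exprn_ge0 ?(ltW rho0) //.
  exact: hC.
have Viter n x : V x -> V (iter n T x) by move=> Vx; elim: n => //= n; exact: VT.
have Vrho x : V x -> nrm (T x) = rho * nrm x.
  move=> Vx; have [->|x0] := eqVneq x 0; first by rewrite linear0 nrm0 mulr0.
  rewrite step_rho ?nrm_gt0 // => n; apply: Vratio; first exact: Viter.
  by rewrite iter_gt0 // nrm_gt0.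
have rho_al : rho < al by rewrite -(ltr_pXn2r (n := 3)) ?nnegrE ?(ltW rho0) // rho3.
have rho2 : rho ^+ 2 != al ^+ 2.
  by rewrite lt_eqF // ltr_pXn2r ?nnegrE // ltW.
have zn0 : z != 0 by rewrite -nrm_gt0.
have [w [c [[Ww _] w0 Tw]]] := invariant_homothety_eigenvector eT rho2 VD VT Vrho Vz zn0.
by move: w0; rewrite (eigen_orth_no_eigenvector Ww Tw) eqxx.
Unshelve. all: by end_near. Qed.

(* T is alpha times an isometry off its eigenvectors, and the self-commutator
   maps H into that part. *)
Lemma star_paranormal_normal (al : R) : 0 <= al -> ess_scalar T al -> normal T.
Proof.
move=> al0 eT; have WT y : eigen_orth T y -> nrm (T y) = al * nrm y.
  by move=> Wy; apply/eqP; rewrite eq_le eigen_orth_op_le // eigen_orth_op_ge.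
(* Every such [y] is critical; testing against the difference itself, which is again orthogonal to
   the eigenvectors, kills it. *)
have TT y : eigen_orth T y -> adjoint T (T y) = (al ^+ 2)%:C *: y.
  move=> Wy; apply/eqP; rewrite -subr_eq0 -nrm_eq0 -sqrf_eq0 -rdotxx.
  set q := _ - _; have Wq : eigen_orth T q.
    rewrite /q addrC -scaleNr; apply: eigen_orthP => //.
    by apply: eigen_orth_adjoint; exact: eigen_orth_op.
  have WD (r : R) x x' : eigen_orth T x -> eigen_orth T x' -> eigen_orth T (x + r%:C *: x').
    by move=> Wx Wx'; rewrite addrC; exact: eigen_orthP.
  have Ws x : eigen_orth T x -> nrm (T x) <= al * nrm x by move=> /WT ->.
  have := norm_attained_critical WD Ws Wy (WT _ Wy) Wq.
  rewrite rdotC rdot_adjoint -rdotZl (rdotC _ q) => h.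
  by rewrite {2}/q rdotBr h subrr.
have TT' y : eigen_orth T y -> T (adjoint T y) = (al ^+ 2)%:C *: y.
  move=> Wy; have WSy := eigen_orth_inv spT TS ST Wy.
  by rewrite -[y in LHS]ST TT // linearZ /= ST.
(* Paired with an eigenvector for [c], both terms yield the squared modulus of [c] times
   [inner y v]. *)
have WN y : eigen_orth T (adjoint T (T y) - T (adjoint T y)).
  move=> v c Tv; have Tv' := adjoint_eigenvector spT Tv.
  rewrite innerBl -adjointEr Tv innerZr !adjointE Tv' !innerZr -adjointEr Tv.
  by rewrite innerZr mulrCA subrr.
apply/funext => y /=; apply/eqP; rewrite -subr_eq0 -nrm_eq0 -sqrf_eq0 -rdotxx.
set q := _ - _; have Wq : eigen_orth T q := WN y.
have e1 : rdot q (adjoint T (T y)) = al ^+ 2 * rdot q y.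
  by rewrite -rdot_adjoint rdotC rdot_adjoint TT // rdotZr rdotC.
have e2 : rdot q (T (adjoint T y)) = al ^+ 2 * rdot q y.
  by rewrite rdotC rdot_adjoint rdotC -rdot_adjoint TT' // rdotZl.
by rewrite {2}/q rdotBr e1 e2 subrr.
Qed.

End InvertibleStarParanormal.

Theorem theorem2p19 (R : realType) (H : hilbertType R) (T : 'B(H)) :
  infinite_dimensional H ->
  closure [set S : 'B(H) | absolutely_norm_attaining S] T ->
  star_paranormal T ->
  invertible T ->
  normal T.
Proof.
move=> infH cT spT [S [TS ST]].
have [al al0 eT] := ess_dichotomy_scalar infH (closure_dichotomy cT).

exact: (star_paranormal_normal spT TS ST al0 eT).
Qed.
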